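(* Let $d\ge1$ be fixed. The sets $\mathcal L^d(T_1,\dots,T_k;T)$ are the components of a $\Theta_d$-colored symmetric operad $\mathcal L^d$. For each complexity $c=(c_1,\dots,c_d)$ the subsets $\mathcal L^d_c(T_1,\dots,T_k;T)\subset\mathcal L^d(T_1,\dots,T_k;T)$, formed by the generalised lattice paths of total complexity component-wise $\le c$, are the components of a symmetric suboperad $\mathcal L^d_c\subset\mathcal L^d$.
   Context: **Trees and $\Theta_d$.** A $d$-level tree $T$ is a sequence of order-preserving maps $t_d\xrightarrow{i_{d-1}}t_{d-1}\to\cdots\xrightarrow{i_0}t_0$ of finite, possibly empty, linearly ordered sets with $t_0$ a singleton. Its disk $\overline T$ consists of sets $\overline t_0=t_0,\overline t_1,\dots,\overline t_d$ with $t_k\subset\overline t_k$ (elements of $t_k$ are internal, the others external) and maps $i_k:\overline t_{k+1}\to\overline t_k$, $\alpha_k,\beta_k:\overline t_k\to\overline t_{k+1}$ with $i_k\alpha_k=i_k\beta_k=\mathrm{id}$, built recursively: the fibre of $i_k$ over an internal $x\in t_k$ is the linearly ordered set $i_k^{-1}(x)\subset t_{k+1}$ with a new minimum $\alpha_k(x)$ and a distinct new maximum $\beta_k(x)$ adjoined; the fibre over an external $x$ is the single point $\alpha_k(x)=\beta_k(x)$; all adjoined points are external. A disk map is a family of maps of the level sets commuting with all $i_k,\alpha_k,\beta_k$ and weakly order-preserving on fibres. $\Theta_d$ has the $d$-level trees as objects and $\Theta_d(S,T)$ is the set of disk maps $\overline T\to\overline S$. **Generalised disks.** In a small category, a minimum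 (maximum) is an object which is not the target (source) of any non-identity arrow. A generalised interval is a connected small category with a unique minimum and a unique maximum, distinct unless the category is terminal (degenerate). A generalised $d$-disk is a family of sets $X_0,\dots,X_d$ with maps $i_k:X_{k+1}\to X_k$, $\alpha_k,\beta_k:X_k\to X_{k+1}$ satisfying $\alpha_{k+1}\alpha_k=\beta_{k+1}\alpha_k$, $\alpha_{k+1}\beta_k=\beta_{k+1}\beta_k$, $i_k\alpha_k=i_k\beta_k=\mathrm{id}$, $X_0$ a singleton, with generalised interval structures with object sets $i_k^{-1}(x)$, minimum $\alpha_k(x)$, maximum $\beta_k(x)$ (degenerate if $x\in\alpha_{k-1}(X_{k-1})\cup\beta_{k-1}(X_{k-1})$). Morphisms are families of maps commuting with the structure maps together with functors $i_k^{-1}(x)\to i_k^{-1}(f(x))$ having these maps on objects. Denote the category by $\mathrm{GDisk}_d$; $\overline T\in\mathrm{GDisk}_d$ with linear orders regarded as categories. The funny product $C\square D$ of categories has objects $\mathrm{Ob}\,C\times\mathrm{Ob}\,D$ and morphisms generated by $f\square\mathrm{id}$, $\mathrm{id}\square g$ subject only to functoriality in each variable separately; for generalised disks $(X\square Y)_k=X_k\times Y_k$ with fibres $i_k^{-1}(x)\square i_k^{-1}(y)$. **The operad.** $\mathcal L^d(T_1,\dots,T_k;T)=\mathrm{GDisk}_d(\overline T,\overline T_1\square\cdots\square\overline T_k)$. Composition: $\omega:\overline T\to\overline S_1\square\cdots\square\overline S_s$ and $\omega_q:\overline S_q\to\square_p\overline T_{q,p}$ compose to $(\omega_1\square\cdots\square\omega_s)\circ\omega$;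 symmetric groups permute the factors; the unary operations are $\mathcal L^d(T_1;T)=\Theta_d(T_1,T)$. **Complexity.** Let $\omega\in\mathcal L^d(T_1,\dots,T_k;T)$ have components $\phi_\ell=(\phi_\ell^1,\dots,\phi_\ell^k)$ at level $\ell$. For $1\le\ell\le d$ and an internal point $a\in t_{\ell-1}$ one gets a functor from the linear order $i_{\ell-1}^{-1}(a)$ to the funny product of the linear orders $i_{\ell-1}^{-1}(\phi^r_{\ell-1}(a))$, $1\le r\le k$; the image of $\min\to\max$ is a sequence of unit steps along the coordinate directions, i.e. a word in $1,\dots,k$ (a lattice path). For $i<j$ the complexity of its $(i,j)$-projection is the number of direction changes (consecutive distinct letters) in the word obtained by keeping only the letters $i,j$. Then $c_\ell(\omega)$ is the maximum of these numbers over all $a\in t_{\ell-1}$ and all $i<j$, and the total complexity of $\omega$ is $(c_1(\omega),\dots,c_d(\omega))$. *)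

(* Defs.v *)
From mathcomp Require Import all_boot all_order all_fingroup.
From mathcomp Require Import generic_quotient.
From mathcomp Require Import boolp.
From Stdlib Require Import Relations.

Set Implicit Arguments.
Unset Strict Implicit.
Unset Printing Implicit Defensive.

Import Order.TTheory.
Local Open Scope quotient_scope.

(* cmp is composition in diagrammatic order.                                  *)
Record category (O : Type) := Category {
  hom : O -> O -> Type;
  idn : forall x, hom x x;
  cmp : forall x y z, hom x y -> hom y z -> hom x z;
  idn_cmp : forall x y (f : hom x y), cmp (idn x) f = f;
  cmp_idn : forall x y (f : hom x y), cmp f (idn y) = f;
  cmpA : forall x y z t (f : hom x y) (g : hom y z) (k : hom z t),
    cmp f (cmp g k) = cmp (cmp f g) k }.

Arguments hom {O} c x y.
Arguments idn {O} c x.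
Arguments cmp {O} c [x y z] f g.

Section Category.
Variables (O : Type) (C : category O).

Definition hom_cast x x' y y' (ex : x = x') (ey : y = y') (f : hom C x y) :
    hom C x' y' :=
  match ex in _ = a, ey in _ = b return hom C a b with erefl, erefl => f end.

Variant is_id (x : O) : forall y, hom C x y -> Prop := IsId : is_id (idn C x).

Definition minimal (x : O) : Prop := forall y (f : hom C y x), is_id f.
Definition maximal (x : O) : Prop := forall y (f : hom C x y), is_id f.

Definition connected : Prop :=
  forall x y, clos_refl_sym_trans _ (fun x y => inhabited (hom C x y)) x y.

Definition terminal : Prop :=
  exists x, (forall y, y = x) /\ (forall f : hom C x x, f = idn C x).

Record gen_interval (lo hi : O) : Prop := GenInterval {
  gi_connected : connected;
  gi_min : unique minimal lo;
  gi_max : unique maximal hi;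
  gi_degenerate : lo = hi -> terminal }.

Definition full (P : O -> Prop) : category {x : O | P x}.
Proof.
by refine (@Category _ (fun x y => hom C (sval x) (sval y))
    (fun x => idn C (sval x)) (fun x y z f g => cmp C f g) _ _ _) => *;
  [exact: idn_cmp|exact: cmp_idn|exact: cmpA].
Defined.

Definition fibre (B : Type) (p : O -> B) (b : B) : category {x : O | p x = b} :=
  full (fun x => p x = b).

Lemma is_id_eq x y (f : hom C x y) (e : x = y) :
  is_id f -> f = hom_cast erefl e (idn C x).
Proof. by move=> H; case: y f / H e => e; rewrite (Prop_irrelevance e erefl). Qed.

Lemma is_id_ob x y (f : hom C x y) : is_id f -> x = y.
Proof. by case. Qed.

Lemma is_id_cast x x' y y' (ex : x = x') (ey : y = y') (f : hom C x y) :
  is_id (hom_cast ex ey f) -> is_id f.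
Proof. by case: _ / ex; case: _ / ey. Qed.

Lemma hom_cast_id x y (e e' : x = y) : hom_cast e e' (idn C x) = idn C y.
Proof. by rewrite (Prop_irrelevance e' e); case: _ / e. Qed.

Lemma hom_cast_cast x x' x'' y y' y'' (ex : x = x') (ex' : x' = x'')
    (ey : y = y') (ey' : y' = y'') (f : hom C x y) :
  hom_cast ex' ey' (hom_cast ex ey f) = hom_cast (etrans ex ex') (etrans ey ey') f.
Proof. by case: _ / ex'; case: _ / ey'. Qed.

Lemma hom_cast_cmp x x' y y' z z' (ex : x = x') (ey ey' : y = y') (ez : z = z')
    (f : hom C x y) (g : hom C y z) :
  cmp C (hom_cast ex ey f) (hom_cast ey' ez g) = hom_cast ex ez (cmp C f g).
Proof.
by rewrite (Prop_irrelevance ey' ey); case: _ / ex; case: _ / ey; case: _ / ez.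
Qed.

Lemma idn_cast_cmp x y z (e : x = y) (e' : y = z) (e'' : x = z) :
  cmp C (hom_cast erefl e (idn C x)) (hom_cast erefl e' (idn C y)) =
    hom_cast erefl e'' (idn C x).
Proof.
by case: _ / e' e'' => e''; rewrite (Prop_irrelevance e'' e) /= cmp_idn.
Qed.

Lemma minimal_terminal x : (forall y, y = x) -> minimal x -> terminal.
Proof.
move=> ux mx; exists x; split=> // f.
exact: (is_id_eq erefl (mx _ f)).
Qed.

Lemma terminal_minimal x : terminal -> minimal x.
Proof.
move=> [z [uz idz]] y f; have ex := uz x; have ey := uz y; subst x y.
by rewrite (idz f); apply: IsId.
Qed.

End Category.

Arguments hom_cast {O} C [x x' y y'] ex ey f.

Lemma full_is_idP O (C : category O) (P : O -> Prop) (a b : {x | P x})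
    (f : hom (full C P) a b) :
  is_id f <-> is_id (C := C) (f : hom C (sval a) (sval b)).
Proof.
split; first by move=> H; case: b f / H; apply: IsId.
case: a b f => a pa [b pb] /= f H.
case: b f / H pb => pb; rewrite (Prop_irrelevance pb pa).
exact: (IsId (full C P) (exist _ a pa)).
Qed.

Lemma full_minimal O (C : category O) (P : O -> Prop) (a : {x | P x}) :
  (forall x y, hom C x y -> P y -> P x) ->
  minimal (full C P) a <-> minimal C (sval a).
Proof.
move=> PC; split=> [m y f|m y f]; last by apply/full_is_idP/m.
have py : P y by apply: PC f (svalP a).
exact/(full_is_idP (a := exist _ y py))/m.
Qed.

Lemma full_maximal O (C : category O) (P : O -> Prop) (a : {x | P x}) :
  (forall x y, hom C x y -> P x -> P y) ->
  maximal (full C P) a <-> maximal C (sval a).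
Proof.
move=> PC; split=> [m y f|m y f]; last by apply/full_is_idP/m.
have py : P y by apply: PC f (svalP a).
exact/(full_is_idP (b := exist _ y py))/m.
Qed.

(* Funny product of a finite family of categories: the arrows are the walks
   of steps in one coordinate, modulo functoriality in each coordinate.       *)

Section Funny.
Variables (I : finType) (O : I -> Type) (C : forall i, category (O i)).
Implicit Types x y z : forall i, O i.

Variant step x y : Type :=
  Step (i : I) of hom (C i) (x i) (y i) & (forall j, j != i -> x j = y j).

Inductive walk : (forall i, O i) -> (forall i, O i) -> Type :=
| wnil x : walk x x
| wcons x y z of step x y & walk y z : walk x z.

Fixpoint wcat x y z (p : walk x y) : walk y z -> walk x z :=
  match p with wnil _ => id | wcons _ _ _ s p' => fun q => wcons s (wcat p' q) end.

Inductive walk_eq : forall x y, walk x y -> walk x y -> Prop :=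
| weq_refl x y (p : walk x y) : walk_eq p p
| weq_sym x y (p q : walk x y) of walk_eq p q : walk_eq q p
| weq_trans x y (p q r : walk x y) of walk_eq p q & walk_eq q r : walk_eq p r
| weq_cons x y z (s : step x y) (p q : walk y z) of walk_eq p q :
    walk_eq (wcons s p) (wcons s q)
| weq_idn x y i (e : forall j, j != i -> x j = x j) (p : walk x y) :
    walk_eq (wcons (Step (idn (C i) (x i)) e) p) p
| weq_cmp x y z t i (f : hom (C i) (x i) (y i)) (g : hom (C i) (y i) (z i))
    e e' e'' (p : walk z t) :
    walk_eq (wcons (Step f e) (wcons (Step g e') p))
            (wcons (Step (cmp (C i) f g) e'') p).

Definition walk_rel x y : rel {classic walk x y} := fun p q => `[< walk_eq p q >].

Lemma walk_rel_equiv x y : equiv_class_of (@walk_rel x y).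
Proof.
split=> [p|p q|q p r].
- by apply/asboolP/weq_refl.
- by apply/asboolP/asboolP => /weq_sym.
- by move=> /asboolP pq /asboolP qr; apply/asboolP; apply: weq_trans pq qr.
Qed.

Canonical walk_equiv x y := EquivRelPack (@walk_rel_equiv x y).

Definition funny_hom x y := {eq_quot (@walk_rel x y)}.

Definition wclass x y (p : walk x y) : funny_hom x y :=
  \pi_(funny_hom x y) (p : {classic walk x y}).
Definition wrepr x y (m : funny_hom x y) : walk x y := repr m.

Lemma wclass_eq x y (p q : walk x y) : wclass p = wclass q <-> walk_eq p q.
Proof.
by split=> [/eqmodP/asboolP //|pq]; apply/eqmodP/asboolP.
Qed.

Lemma wreprK x y (m : funny_hom x y) : wclass (wrepr m) = m.
Proof. exact: reprK. Qed.

Lemma wrepr_class x y (p : walk x y) : walk_eq (wrepr (wclass p)) p.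
Proof. by apply/wclass_eq; rewrite wreprK. Qed.

Lemma wcat_eql x y z (p p' : walk x y) (q : walk y z) :
  walk_eq p p' -> walk_eq (wcat p q) (wcat p' q).
Proof.
move=> E; elim: E q => {x y p p'} /=.
- by move=> *; apply: weq_refl.
- by move=> x y p q _ IH r; apply: weq_sym.
- by move=> x y p q r _ IH1 _ IH2 t; apply: weq_trans (IH1 t) (IH2 t).
- by move=> x y t s p q _ IH r; apply: weq_cons.
- by move=> *; apply: weq_idn.
- by move=> *; apply: weq_cmp.
Qed.

Lemma wcat_eqr x y z (p : walk x y) (q q' : walk y z) :
  walk_eq q q' -> walk_eq (wcat p q) (wcat p q').
Proof. by elim: p q q' => //= *; apply: weq_cons; auto. Qed.

Lemma wcatw0 x y (p : walk x y) : wcat p (wnil y) = p.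
Proof. by elim: p => //= ? ? ? s p ->. Qed.

Lemma wcatA x y z t (p : walk x y) (q : walk y z) (r : walk z t) :
  wcat p (wcat q r) = wcat (wcat p q) r.
Proof. by elim: p q => //= ? ? ? s p IH q; rewrite IH. Qed.

Definition funny_cmp x y z (m : funny_hom x y) (n : funny_hom y z) :
  funny_hom x z := wclass (wcat (wrepr m) (wrepr n)).

Lemma funny_cmp_class x y z (p : walk x y) (q : walk y z) :
  funny_cmp (wclass p) (wclass q) = wclass (wcat p q).
Proof.
apply/wclass_eq; apply: weq_trans (wcat_eql _ (wrepr_class p)) _.
exact: wcat_eqr (wrepr_class q).
Qed.

Definition funny : category (forall i, O i).
Proof.
refine (@Category _ funny_hom (fun x => wclass (wnil x)) funny_cmp _ _ _).
- by move=> x y m; rewrite -(wreprK m) funny_cmp_class.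
- by move=> x y m; rewrite -(wreprK m) funny_cmp_class wcatw0.
- move=> x y z t m n l; rewrite -(wreprK m) -(wreprK n) -(wreprK l).
  by rewrite !funny_cmp_class wcatA.
Defined.

Definition gen x y (s : step x y) : hom funny x y := wclass (wcons s (wnil y)).

Lemma gen_idn x i e : gen (@Step x x i (idn (C i) (x i)) e) = idn funny x.
Proof. exact/wclass_eq/weq_idn. Qed.

Lemma gen_cmp x y z i (f : hom (C i) (x i) (y i)) (g : hom (C i) (y i) (z i))
    e e' e'' :
  cmp funny (gen (Step f e)) (gen (Step g e')) = gen (Step (cmp (C i) f g) e'').
Proof. by rewrite /= funny_cmp_class; apply/wclass_eq/weq_cmp. Qed.

Lemma wclass_cons x y z (s : step x y) (p : walk y z) :
  wclass (wcons s p) = cmp funny (gen s) (wclass p).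
Proof. by rewrite /= funny_cmp_class. Qed.

(* Universal property: a functor out of the funny product is an action of
   the steps which is functorial in each coordinate separately.               *)

Section Rec.
Variables (O' : Type) (D : category O') (F : (forall i, O i) -> O').
Variable act : forall x y, step x y -> hom D (F x) (F y).

Fixpoint walk_fold x y (p : walk x y) : hom D (F x) (F y) :=
  match p with
  | wnil x => idn D (F x)
  | wcons _ _ _ s p' => cmp D (act s) (walk_fold p')
  end.

Definition funny_rec x y (m : hom funny x y) : hom D (F x) (F y) :=
  walk_fold (wrepr m).

Hypothesis act_idn : forall x i e, act (@Step x x i (idn (C i) (x i)) e) = idn D (F x).
Hypothesis act_cmp : forall x y z i
    (f : hom (C i) (x i) (y i)) (g : hom (C i) (y i) (z i)) e e' e'',
  cmp D (act (Step f e)) (act (Step g e')) =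
    act (@Step x z i (cmp (C i) f g) e'').

Lemma walk_fold_eq x y (p q : walk x y) : walk_eq p q -> walk_fold p = walk_fold q.
Proof.
elim=> {x y p q} //=.
- by move=> x y p q r _ -> _ ->.
- by move=> x y z s p q _ ->.
- by move=> x y i e p; rewrite act_idn idn_cmp.
- by move=> x y z t i f g e e' e'' p; rewrite cmpA (act_cmp _ _ _ _ e'').
Qed.

Lemma funny_rec_class x y (p : walk x y) : funny_rec (wclass p) = walk_fold p.
Proof. exact/walk_fold_eq/wrepr_class. Qed.

Lemma funny_rec_idn x : funny_rec (idn funny x) = idn D (F x).
Proof. exact: funny_rec_class. Qed.

Lemma funny_rec_gen x y (s : step x y) : funny_rec (gen s) = act s.
Proof. by rewrite funny_rec_class /= cmp_idn. Qed.

Lemma walk_fold_cat x y z (p : walk x y) (q : walk y z) :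
  walk_fold (wcat p q) = cmp D (walk_fold p) (walk_fold q).
Proof. by elim: p q => [u|u v w s p IH] q /=; rewrite ?idn_cmp // IH cmpA. Qed.

Lemma funny_rec_cmp x y z (m : hom funny x y) (n : hom funny y z) :
  funny_rec (cmp funny m n) = cmp D (funny_rec m) (funny_rec n).
Proof. by rewrite /funny_rec [LHS]funny_rec_class walk_fold_cat. Qed.

End Rec.

Section Projection.
Variable i : I.

Definition proj_act x y (s : step x y) : hom (C i) (x i) (y i) :=
  let: Step j f e := s in
  match decP (i =P j) with
  | left ij => eq_rect j (fun j => hom (C j) (x j) (y j)) f i (esym ij)
  | right ij => hom_cast (C i) erefl (e i (introN eqP ij)) (idn (C i) (x i))
  end.

Definition proj x y (m : hom funny x y) : hom (C i) (x i) (y i) :=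
  funny_rec (F := fun x => x i) proj_act m.

Let proj_act_idn x j e : proj_act (@Step x x j (idn (C j) (x j)) e) = idn (C i) (x i).
Proof.
rewrite /proj_act; case: decP => [ij|ij]; first by case: _ / (esym ij).
by rewrite (Prop_irrelevance (e i _) erefl).
Qed.

Let proj_act_cmp x y z j (f : hom (C j) (x j) (y j)) (g : hom (C j) (y j) (z j))
    e e' e'' :
  cmp (C i) (proj_act (Step f e)) (proj_act (Step g e')) =
    proj_act (@Step x z j (cmp (C j) f g) e'').
Proof.
rewrite /proj_act; case: decP => [ij|ij]; first by case: _ / (esym ij).
exact: idn_cast_cmp.
Qed.

Lemma proj_idn x : proj (idn funny x) = idn (C i) (x i).
Proof. exact: funny_rec_idn. Qed.

Lemma proj_gen x y (f : hom (C i) (x i) (y i)) e : proj (gen (Step f e)) = f.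
Proof.
rewrite /proj funny_rec_gen //= /proj_act; case: decP => // ij.
by rewrite (Prop_irrelevance (esym ij) erefl).
Qed.

Lemma proj_is_id x y (m : hom funny x y) : is_id m -> is_id (proj m).
Proof. by case; rewrite proj_idn; apply: IsId. Qed.

End Projection.

Lemma gen_is_id x y i (f : hom (C i) (x i) (y i)) e :
  is_id f -> is_id (gen (Step f e)).
Proof.
move=> idf; have exy : x = y.
  apply: functional_extensionality_dep => j.
  by have [->|/e //] := eqVneq j i; apply: is_id_ob idf.
case: y / exy f e idf => f e idf.
by rewrite (is_id_eq erefl idf) /= gen_idn; apply: IsId.
Qed.

Lemma dfwith_agree x i (a : O i) : forall j, j != i -> dfwith x a j = x j.
Proof. by move=> j ji; rewrite dfwith_out // eq_sym. Qed.

Lemma funny_minimal z : minimal funny z <-> forall i, minimal (C i) (z i).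
Proof.
split=> [mz i a f|mz y m].
  have e : dfwith z a i = a by apply: dfwith_in.
  pose s := Step (hom_cast (C i) (esym e) erefl f) (dfwith_agree z a).
  by have := @proj_is_id i _ _ _ (mz _ (gen s)); rewrite proj_gen; apply: is_id_cast.
rewrite -(wreprK m); elim: (wrepr m) mz => {y z m} [x|x y z s p IH] mz.
  exact: (IsId funny).
rewrite wclass_cons; have := IH mz; move: (wclass p) => m idm.
case: z m / idm {p IH} mz => mz; rewrite cmp_idn.
by case: s => i f e; apply/gen_is_id/mz.
Qed.

Lemma funny_maximal z : maximal funny z <-> forall i, maximal (C i) (z i).
Proof.
split=> [mz i a f|mz y m].
  have e : dfwith z a i = a by apply: dfwith_in.
  pose s := Step (hom_cast (C i) erefl (esym e) f)
                 (fun j ji => esym (dfwith_agree z a ji)).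
  by have := @proj_is_id i _ _ _ (mz _ (gen s)); rewrite proj_gen; apply: is_id_cast.
rewrite -(wreprK m); elim: (wrepr m) mz => {y z m} [x|x y z s p IH] mz.
  exact: (IsId funny).
have ids : is_id (gen s) by case: s => i f e; apply/gen_is_id/mz.
rewrite wclass_cons; move: (gen s) ids => t ids {s}.
by case: y t / ids p IH => p IH; rewrite idn_cmp; apply: IH.
Qed.

End Funny.

Section FunnyFibre.
Variables (I : finType) (O : I -> Type) (C : forall i, category (O i)).
Variables (B : I -> Type) (p : forall i, O i -> B i).
Hypothesis Cp : forall i y z, hom (C i) y z -> p y = p z.
Implicit Types x y z : forall i, O i.

Local Notation P := (fun y i => p (y i)).

Lemma walk_over y z : walk C y z -> P y = P z.
Proof.
elim=> // {y z} x y z [i f e] _ <-.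
apply: functional_extensionality_dep => j.
by have [->|/e ->] := eqVneq j i; first exact: Cp f.
Qed.

Lemma funny_over y z : hom (funny C) y z -> P y = P z.
Proof. by move=> m; apply: walk_over (wrepr m). Qed.

Variable b : forall i, B i.

Let Cb i : forall u v, hom (C i) u v -> p u = b i -> p v = b i.
Proof. by move=> u v /Cp ->. Qed.
Let Cb' i : forall u v, hom (C i) u v -> p v = b i -> p u = b i.
Proof. by move=> u v /Cp ->. Qed.
Let Fb y z : hom (funny C) y z -> P y = b -> P z = b.
Proof. by move=> /funny_over ->. Qed.
Let Fb' y z : hom (funny C) y z -> P z = b -> P y = b.
Proof. by move=> /funny_over ->. Qed.

Lemma fibre_funny_minimal (z : {y | P y = b}) :
  minimal (fibre (funny C) P b) z <->
  forall i, minimal (fibre (C i) (@p i) (b i))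
                    (exist _ (sval z i) (congr1 (fun u => u i) (svalP z))).
Proof.
split=> [m i|m].
  apply/(full_minimal _ (@Cb' i)).
  have /(full_minimal _ Fb') /funny_minimal := m; exact.
apply/(full_minimal _ Fb')/funny_minimal => i.
by have /(full_minimal _ (@Cb' i)) := m i.
Qed.

Lemma fibre_funny_maximal (z : {y | P y = b}) :
  maximal (fibre (funny C) P b) z <->
  forall i, maximal (fibre (C i) (@p i) (b i))
                    (exist _ (sval z i) (congr1 (fun u => u i) (svalP z))).
Proof.
split=> [m i|m].
  apply/(full_maximal _ (@Cb i)).
  have /(full_maximal _ Fb) /funny_maximal := m; exact.
apply/(full_maximal _ Fb)/funny_maximal => i.
by have /(full_maximal _ (@Cb i)) := m i.
Qed.

Let fibre_eq (y z : {y | P y = b}) :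
  (forall i, sval y i = sval z i) -> y = z.
Proof.
case: y z => y ey [z ez] /= e; have {}e : y = z by exact/functional_extensionality_dep.
by case: z / e ez => ez; rewrite (Prop_irrelevance ez ey).
Qed.

Lemma fibre_funny_terminal :
  (forall i, terminal (fibre (C i) (@p i) (b i))) ->
  terminal (fibre (funny C) P b).
Proof.
move=> tC.
have uni i (u v : {y | p y = b i}) : u = v by have [w [wu _]] := tC i; rewrite (wu u).
pose x0 i := sval (projT1 (cid (tC i))).
have x0b : P x0 = b.
  apply: functional_extensionality_dep => i; exact: svalP (projT1 (cid (tC i))).
apply: (@minimal_terminal _ _ (exist _ x0 x0b)) => [[y yb]|].
  apply: fibre_eq => i /=.
  exact: (congr1 sval (uni i (exist _ (y i) (congr1 (fun u => u i) yb))
                             (exist _ (x0 i) (congr1 (fun u => u i) x0b)))).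
apply/fibre_funny_minimal => i; apply: terminal_minimal (tC i).
Qed.

Lemma fibre_funny_connected :
  (forall i, connected (fibre (C i) (@p i) (b i))) ->
  connected (fibre (funny C) P b).
Proof.
move=> cC y z.
suff [s sP] : exists s : seq I, forall i, i \notin s -> sval y i = sval z i.
  elim: s y sP => [|i s IH] y sP.
    by rewrite (fibre_eq (fun i => sP i isT)); apply: rst_refl.
  case: y sP => y yb /= sP.
  have inb (u : {y | p y = b i}) : P (dfwith y (sval u)) = b.
    apply: functional_extensionality_dep => j.
    case: dfwithP => [|k _]; first exact: svalP u.
    exact: (congr1 (fun u => u k) yb).
  pose F (u : {y | p y = b i}) : {y | P y = b} := exist _ _ (inb u).
  pose yi : {y | p y = b i} := exist _ (y i) (congr1 (fun u => u i) yb).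
  pose zi : {y | p y = b i} := exist _ (sval z i) (congr1 (fun u => u i) (svalP z)).
  apply: (@rst_trans _ _ _ (F zi)); last first.
    apply: IH => j js; rewrite /F /=.
    case: (eqVneq i j) => [<-|ij]; first by rewrite dfwith_in.
    by rewrite dfwith_out // sP // in_cons negb_or eq_sym ij.
  have -> : exist _ y yb = F yi.
    apply: fibre_eq => j /=.
    by case: (eqVneq i j) => [<-|ij]; rewrite ?dfwith_in ?dfwith_out.
  move: (cC i yi zi); elim => [u v [f]|u|u v _ IHu|u v w _ IHu _ IHv].
  - apply: rst_step; constructor.
    have eu : dfwith y (sval u) i = sval u by exact: dfwith_in.
    have ev : dfwith y (sval v) i = sval v by exact: dfwith_in.
    apply: (gen (Step (hom_cast (C i) (esym eu) (esym ev) f) _)) => j ji.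
    by rewrite !dfwith_agree.
  - exact: rst_refl.
  - exact: rst_sym.
  - exact: rst_trans IHu IHv.
by exists (enum I) => i; rewrite mem_enum.
Qed.

Lemma fibre_funny_interval (l h : forall i, O i) el eh el' eh' :
  (forall i, gen_interval (fibre (C i) (@p i) (b i))
               (exist _ (l i) (el i)) (exist _ (h i) (eh i))) ->
  gen_interval (fibre (funny C) P b) (exist _ l el') (exist _ h eh').
Proof.
move=> iC; split.
- by apply: fibre_funny_connected => i; have [] := iC i.
- split=> [|z /fibre_funny_minimal mz].
    apply/fibre_funny_minimal => i; have [_ [mi _] _ _] := iC i.
    by move: (congr1 _ _) => e; rewrite /= in e *; rewrite (Prop_irrelevance e (el i)).
  apply: fibre_eq => i; have [_ [_ u] _ _] := iC i.
  exact: (congr1 sval (u _ (mz i))).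
- split=> [|z /fibre_funny_maximal mz].
    apply/fibre_funny_maximal => i; have [_ _ [mi _] _] := iC i.
    by move: (congr1 _ _) => e; rewrite /= in e *; rewrite (Prop_irrelevance e (eh i)).
  apply: fibre_eq => i; have [_ _ [_ u] _] := iC i.
  exact: (congr1 sval (u _ (mz i))).
- move=> /(congr1 sval) /= elh; apply: fibre_funny_terminal => i.
  have [_ _ _] := iC i; apply.
  move: (el i) (eh i); rewrite elh => e e'; by rewrite (Prop_irrelevance e e').
Qed.

End FunnyFibre.

(* Generalised d-disks.  The levels are indexed by k with a proof of k <= d.
   As the fibres of i_k : X_(k+1) -> X_k are disjoint, the categories on them
   are given together, as one category on X_(k+1) all of whose arrows lie in
   fibres of i_k.                                                             *)

Record gdisk (d : nat) := GDisk {
  lev : forall k, k <= d -> Type;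
  dn : forall k (h : k < d), lev h -> lev (ltnW h);
  lo : forall k (h : k < d), lev (ltnW h) -> lev h;
  hi : forall k (h : k < d), lev (ltnW h) -> lev h;
  arr : forall k (h : k < d), category (lev h);
  dn_lo : forall k (h : k < d) (x : lev (ltnW h)), dn (lo x) = x;
  dn_hi : forall k (h : k < d) (x : lev (ltnW h)), dn (hi x) = x;
  lo_lo : forall k (h : k.+1 < d) (x : lev (ltnW (ltnW h))),
    lo (lo x) = hi (lo x) :> lev h;
  lo_hi : forall k (h : k.+1 < d) (x : lev (ltnW (ltnW h))),
    lo (hi x) = hi (hi x) :> lev h;
  lev0_singleton : exists x : lev (leq0n d), forall y, y = x;
  arr_dn : forall k (h : k < d) (y z : lev h), hom (arr h) y z -> dn y = dn z;
  interval : forall k (h : k < d) (x : lev (ltnW h)),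
    gen_interval (fibre (arr h) (@dn k h) x)
      (exist _ (lo x) (dn_lo x)) (exist _ (hi x) (dn_hi x));
  degenerate_lo : forall k (h : k.+1 < d) (x : lev (ltnW (ltnW h))),
    terminal (fibre (arr h) (@dn k.+1 h) (lo x));
  degenerate_hi : forall k (h : k.+1 < d) (x : lev (ltnW (ltnW h))),
    terminal (fibre (arr h) (@dn k.+1 h) (hi x)) }.

Arguments lev {d} g [k] h.
Arguments dn {d} g [k] h y.
Arguments lo {d} g [k] h x.
Arguments hi {d} g [k] h x.
Arguments arr {d} g [k] h.

Record gdisk_map (d : nat) (X Y : gdisk d) := GDiskMap {
  gfun : forall k (h : k <= d), lev X h -> lev Y h;
  garr : forall k (h : k < d) (y z : lev X h),
    hom (arr X h) y z -> hom (arr Y h) (gfun y) (gfun z);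
  gfun_dn : forall k (h : k < d) (y : lev X h), gfun (dn X h y) = dn Y h (gfun y);
  gfun_lo : forall k (h : k < d) (x : lev X (ltnW h)),
    gfun (lo X h x) = lo Y h (gfun x);
  gfun_hi : forall k (h : k < d) (x : lev X (ltnW h)),
    gfun (hi X h x) = hi Y h (gfun x);
  garr_idn : forall k (h : k < d) (x : lev X h),
    garr (idn (arr X h) x) = idn (arr Y h) (gfun x);
  garr_cmp : forall k (h : k < d) (x y z : lev X h)
    (f : hom (arr X h) x y) (g : hom (arr X h) y z),
    garr (cmp (arr X h) f g) = cmp (arr Y h) (garr f) (garr g) }.

Arguments gfun {d X Y} F [k] h y : rename.
Arguments garr {d X Y} F [k] h [y z] f : rename.

Section GDisk.
Variable d : nat.
Implicit Types X Y Z : gdisk d.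

Definition gdisk_comp X Y Z (G : gdisk_map Y Z) (F : gdisk_map X Y) :
  gdisk_map X Z.
Proof.
refine (@GDiskMap d X Z (fun k h y => gfun G h (gfun F h y))
  (fun k h y z f => garr G h (garr F h f)) _ _ _ _ _) => *.
- by rewrite !gfun_dn.
- by rewrite !gfun_lo.
- by rewrite !gfun_hi.
- by rewrite !garr_idn.
- by rewrite !garr_cmp.
Defined.

Section Product.
Variables (I : finType) (X : I -> gdisk d).

Definition gfunny_lev k (h : k <= d) := forall i, lev (X i) h.
Definition gfunny_dn k (h : k < d) (y : gfunny_lev h) :
    gfunny_lev (ltnW h) := fun i => dn (X i) h (y i).
Definition gfunny_lo k (h : k < d) (x : gfunny_lev (ltnW h)) :
    gfunny_lev h := fun i => lo (X i) h (x i).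
Definition gfunny_hi k (h : k < d) (x : gfunny_lev (ltnW h)) :
    gfunny_lev h := fun i => hi (X i) h (x i).
Definition gfunny_arr k (h : k < d) : category (gfunny_lev h) :=
  funny (fun i => arr (X i) h).

Lemma gfunny_dn_lo k (h : k < d) (x : gfunny_lev (ltnW h)) : gfunny_dn (gfunny_lo x) = x.
Proof. by apply: functional_extensionality_dep => i; apply: dn_lo. Qed.

Lemma gfunny_dn_hi k (h : k < d) (x : gfunny_lev (ltnW h)) : gfunny_dn (gfunny_hi x) = x.
Proof. by apply: functional_extensionality_dep => i; apply: dn_hi. Qed.

Lemma gfunny_lo_lo k (h : k.+1 < d) (x : gfunny_lev (ltnW (ltnW h))) :
  gfunny_lo (gfunny_lo x) = gfunny_hi (gfunny_lo x) :> gfunny_lev h.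
Proof. by apply: functional_extensionality_dep => i; apply: lo_lo. Qed.

Lemma gfunny_lo_hi k (h : k.+1 < d) (x : gfunny_lev (ltnW (ltnW h))) :
  gfunny_lo (gfunny_hi x) = gfunny_hi (gfunny_hi x) :> gfunny_lev h.
Proof. by apply: functional_extensionality_dep => i; apply: lo_hi. Qed.

Lemma gfunny_lev0 : exists x : gfunny_lev (leq0n d), forall y, y = x.
Proof.
exists (fun i => projT1 (cid (lev0_singleton (X i)))) => y.
apply: functional_extensionality_dep => i.
exact: (projT2 (cid (lev0_singleton (X i)))).
Qed.

Lemma gfunny_arr_dn k (h : k < d) (y z : gfunny_lev h) :
  hom (gfunny_arr h) y z -> gfunny_dn y = gfunny_dn z.
Proof. exact: (funny_over (fun i => @arr_dn d (X i) k h)). Qed.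

Lemma gfunny_interval k (h : k < d) (x : gfunny_lev (ltnW h)) :
  gen_interval (fibre (gfunny_arr h) (@gfunny_dn k h) x)
    (exist _ (gfunny_lo x) (gfunny_dn_lo x)) (exist _ (gfunny_hi x) (gfunny_dn_hi x)).
Proof.
exact: (fibre_funny_interval (fun i => @arr_dn d (X i) k h) _ _
  (fun i => @interval d (X i) k h (x i))).
Qed.

Lemma gfunny_deg_lo k (h : k.+1 < d) (x : gfunny_lev (ltnW (ltnW h))) :
  terminal (fibre (gfunny_arr h) (@gfunny_dn k.+1 h) (gfunny_lo x)).
Proof.
exact: (fibre_funny_terminal (fun i => @arr_dn d (X i) k.+1 h)
  (fun i => @degenerate_lo d (X i) k h (x i))).
Qed.

Lemma gfunny_deg_hi k (h : k.+1 < d) (x : gfunny_lev (ltnW (ltnW h))) :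
  terminal (fibre (gfunny_arr h) (@gfunny_dn k.+1 h) (gfunny_hi x)).
Proof.
exact: (fibre_funny_terminal (fun i => @arr_dn d (X i) k.+1 h)
  (fun i => @degenerate_hi d (X i) k h (x i))).
Qed.

Definition gfunny : gdisk d :=
  GDisk gfunny_lo_lo gfunny_lo_hi gfunny_lev0 gfunny_arr_dn gfunny_interval
    gfunny_deg_lo gfunny_deg_hi.

End Product.

End GDisk.

Section FunnyMap.
Variables (d : nat) (I : finType) (X Y : I -> gdisk d).
Variable F : forall i, gdisk_map (X i) (Y i).

Definition fmap_ob k (h : k <= d) (x : lev (gfunny X) h) : lev (gfunny Y) h :=
  fun i => gfun (F i) h (x i).

Definition fmap_act k (h : k < d) (x y : lev (gfunny X) h)
    (s : step (fun i => arr (X i) h) x y) :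
    hom (arr (gfunny Y) h) (fmap_ob x) (fmap_ob y) :=
  let: Step i f e := s in
  gen (@Step I _ (fun i => arr (Y i) h) (fmap_ob x) (fmap_ob y) i
    (garr (F i) h f) (fun j ji => congr1 (gfun (F j) h) (e j ji))).

Lemma fmap_act_idn k (h : k < d) (x : lev (gfunny X) h) i e :
  fmap_act (@Step _ _ _ x x i (idn (arr (X i) h) (x i)) e) =
    idn (arr (gfunny Y) h) (fmap_ob x).
Proof. by rewrite /fmap_act garr_idn; apply: gen_idn. Qed.

Lemma fmap_act_cmp k (h : k < d) (x y z : lev (gfunny X) h) i
    (f : hom (arr (X i) h) (x i) (y i)) (g : hom (arr (X i) h) (y i) (z i))
    e e' e'' :
  cmp (arr (gfunny Y) h) (fmap_act (Step f e)) (fmap_act (Step g e')) =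
    fmap_act (@Step _ _ _ x z i (cmp (arr (X i) h) f g) e'').
Proof. by rewrite /fmap_act garr_cmp; apply: gen_cmp. Qed.

Definition funny_map : gdisk_map (gfunny X) (gfunny Y).
Proof.
refine (@GDiskMap d _ _ fmap_ob
  (fun k h => funny_rec (D := arr (gfunny Y) h) (@fmap_act k h)) _ _ _ _ _).
- by move=> k h y; apply: functional_extensionality_dep => i; apply: gfun_dn.
- by move=> k h y; apply: functional_extensionality_dep => i; apply: gfun_lo.
- by move=> k h y; apply: functional_extensionality_dep => i; apply: gfun_hi.
- by move=> k h; apply: funny_rec_idn; [apply: fmap_act_idn|apply: fmap_act_cmp].
- by move=> k h; apply: funny_rec_cmp; [apply: fmap_act_idn|apply: fmap_act_cmp].
Defined.

End FunnyMap.

Section Reindex.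
Variables (d : nat) (I J : finType) (X : I -> gdisk d).
Variables (u : J -> I) (v : I -> J) (uK : cancel u v) (vK : cancel v u).

Definition reindex_ob k (h : k <= d) (x : lev (gfunny X) h) :
    lev (gfunny (X \o u)) h := fun j => x (u j).

Lemma reindex_off k (h : k <= d) (x y : lev (gfunny X) h) i :
  (forall i', i' != i -> x i' = y i') ->
  forall j, j != v i -> reindex_ob x j = reindex_ob y j.
Proof.
by move=> e j ji; apply: e; apply: contra ji => /eqP <-; rewrite uK.
Qed.

Definition reindex_act k (h : k < d) (x y : lev (gfunny X) h)
    (s : step (fun i => arr (X i) h) x y) :
    hom (arr (gfunny (X \o u)) h) (reindex_ob x) (reindex_ob y) :=
  let: Step i f e := s in
  gen (@Step J _ (fun j => arr (X (u j)) h) (reindex_ob x) (reindex_ob y) (v i)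
    (eq_rect i (fun i => hom (arr (X i) h) (x i) (y i)) f (u (v i)) (esym (vK i)))
    (reindex_off e)).

Lemma reindex_act_idn k (h : k < d) (x : lev (gfunny X) h) i e :
  reindex_act (@Step _ _ _ x x i (idn (arr (X i) h) (x i)) e) =
    idn (arr (gfunny (X \o u)) h) (reindex_ob x).
Proof.
rewrite /reindex_act.
have -> : eq_rect i (fun i => hom (arr (X i) h) (x i) (x i))
    (idn (arr (X i) h) (x i)) (u (v i)) (esym (vK i)) =
  idn (arr (X (u (v i))) h) (x (u (v i))).
  by case: _ / (esym (vK i)).
exact: gen_idn.
Qed.

Lemma reindex_act_cmp k (h : k < d) (x y z : lev (gfunny X) h) i
    (f : hom (arr (X i) h) (x i) (y i)) (g : hom (arr (X i) h) (y i) (z i))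
    e e' e'' :
  cmp (arr (gfunny (X \o u)) h) (reindex_act (Step f e)) (reindex_act (Step g e')) =
    reindex_act (@Step _ _ _ x z i (cmp (arr (X i) h) f g) e'').
Proof.
rewrite /reindex_act.
have -> : eq_rect i (fun i => hom (arr (X i) h) (x i) (z i))
    (cmp (arr (X i) h) f g) (u (v i)) (esym (vK i)) =
  cmp (arr (X (u (v i))) h)
    (eq_rect i (fun i => hom (arr (X i) h) (x i) (y i)) f (u (v i)) (esym (vK i)))
    (eq_rect i (fun i => hom (arr (X i) h) (y i) (z i)) g (u (v i)) (esym (vK i))).
  by case: _ / (esym (vK i)).
exact: gen_cmp.
Qed.

Definition funny_reindex : gdisk_map (gfunny X) (gfunny (X \o u)).
Proof.
refine (@GDiskMap d _ _ reindex_ob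
  (fun k h => funny_rec (D := arr (gfunny (X \o u)) h) (@reindex_act k h)) _ _ _ _ _).
- by [].
- by [].
- by [].
- by move=> k h; apply: funny_rec_idn; [apply: reindex_act_idn|apply: reindex_act_cmp].
- by move=> k h; apply: funny_rec_cmp; [apply: reindex_act_idn|apply: reindex_act_cmp].
Defined.

End Reindex.

Section FunnyUnit.
Variables (d : nat) (X : gdisk d).

Lemma ord1_off (A : Type) (x y : A) (j : 'I_1) : j != ord0 -> x = y.
Proof. by rewrite (ord1 j). Qed.

Definition funny_unit : gdisk_map X (gfunny (fun _ : 'I_1 => X)).
Proof.
refine (@GDiskMap d X (gfunny (fun _ : 'I_1 => X)) (fun k h x _ => x)
  (fun k h y z f => gen (@Step 'I_1 _ (fun _ => arr X h) (fun _ => y) (fun _ => z)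
                           ord0 f (@ord1_off _ y z))) _ _ _ _ _).
- by [].
- by [].
- by [].
- by move=> k h x; apply: gen_idn.
- by move=> k h x y z f g; apply/esym/gen_cmp.
Defined.

End FunnyUnit.

(* An iterated funny product is a funny product over the disjoint union of the
   index sets.                                                                *)

Section FlattenCategory.
Variables (I : finType) (J : I -> finType) (O : forall i, J i -> Type).
Variable C : forall i (j : J i), category (O j).

Local Notation obs := (forall i (j : J i), O j).
Local Notation flatC := (funny (fun u : {i & J i} => C (tagged u))).

Definition flat_ob (x : obs) : forall u : {i & J i}, O (tagged u) :=
  fun u => x (tag u) (tagged u).

(* E embeds the i-th factor, the other coordinates being kept constant.       *)
Section Block.
Variables (i : I) (E : (forall j : J i, O j) -> obs).
Hypotheses (Ein : forall a, @E a i = a)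
           (Eout : forall a b i', i' != i -> @E a i' = @E b i').

Lemma block_off (a b : forall j : J i, O j) (j : J i) :
  (forall j', j' != j -> a j' = b j') ->
  forall u : {i & J i}, u != Tagged (fun i => J i) j ->
  flat_ob (@E a) u = flat_ob (@E b) u.
Proof.
move=> e [i' j'] /=; rewrite /flat_ob /=.
have [ii'|ii' _] := eqVneq i' i; last by rewrite (Eout a b ii').
case: i / ii' j a b e E Ein Eout => j a b e E' Ein' _ /=.
by rewrite eq_Tagged /= !Ein' => /e.
Qed.

Definition block_act (a b : forall j : J i, O j) (s : step (@C i) a b) :
    hom flatC (flat_ob (@E a)) (flat_ob (@E b)) :=
  let: Step j f e := s in
  gen (@Step {i & J i} _ (fun u => C (tagged u)) (flat_ob (@E a)) (flat_ob (@E b))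
    (Tagged (fun i => J i) j)
    (hom_cast (C j) (congr1 (fun g => g j) (esym (Ein a)))
                    (congr1 (fun g => g j) (esym (Ein b))) f)
    (block_off e)).

Lemma block_act_idn a j e :
  block_act (@Step _ _ (@C i) a a j (idn (C j) (a j)) e) = idn flatC (flat_ob (@E a)).
Proof. by rewrite /block_act hom_cast_id; apply: gen_idn. Qed.

Lemma block_act_cmp (a b c : forall j : J i, O j) j
    (f : hom (C j) (a j) (b j)) (g : hom (C j) (b j) (c j)) e e' e'' :
  cmp flatC (block_act (Step f e)) (block_act (Step g e')) =
    block_act (@Step _ _ (@C i) a c j (cmp (C j) f g) e'').
Proof.
rewrite /block_act.
rewrite -(hom_cast_cmp _ (congr1 (fun g => g j) (esym (Ein b)))
            (congr1 (fun g => g j) (esym (Ein b)))).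
exact: gen_cmp.
Qed.

Definition block (a b : forall j : J i, O j) (m : hom (funny (@C i)) a b) :
    hom flatC (flat_ob (@E a)) (flat_ob (@E b)) :=
  funny_rec (D := flatC) (F := fun a => flat_ob (@E a)) block_act m.

Lemma block_idn a : block (idn (funny (@C i)) a) = idn flatC (flat_ob (@E a)).
Proof. exact: (funny_rec_idn block_act_idn block_act_cmp). Qed.

Lemma block_cmp a b c (m : hom (funny (@C i)) a b) (n : hom (funny (@C i)) b c) :
  block (cmp (funny (@C i)) m n) = cmp flatC (block m) (block n).
Proof. exact: (funny_rec_cmp block_act_idn block_act_cmp). Qed.

End Block.

Lemma block_base i (E E' : (forall j : J i, O j) -> obs) Ein Eout Ein' Eout'
    (EE : E = E') a b (m : hom (funny (@C i)) a b) :
  block (E := E') Ein' Eout' m =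
    hom_cast flatC (congr1 (fun E => flat_ob (E a)) EE)
                   (congr1 (fun E => flat_ob (E b)) EE)
                   (block (E := E) Ein Eout m).
Proof.
case: E' / EE Ein' Eout' => Ein' Eout'.
by rewrite (Prop_irrelevance Ein' Ein) (Prop_irrelevance Eout' Eout).
Qed.

Lemma dfwith_const (x : obs) i (a b : forall j : J i, O j) i' :
  i' != i -> dfwith x a i' = dfwith x b i'.
Proof. by move=> ii'; rewrite !dfwith_out // eq_sym. Qed.

Lemma dfwith_self (x y : obs) i :
  (forall i', i' != i -> x i' = y i') -> dfwith x (y i) = y.
Proof.
move=> e; apply: functional_extensionality_dep => i'.
by case: dfwithP => // k ik; apply: e; rewrite eq_sym.
Qed.

Lemma dfwith_base (x y : obs) i :
  (forall i', i' != i -> x i' = y i') ->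
  (fun a => dfwith x a) = (fun a : (forall j : J i, O j) => dfwith y a).
Proof.
move=> e; apply: functional_extensionality_dep => a.
apply: functional_extensionality_dep => i'.
by case: dfwithP => [|k ik]; rewrite ?dfwith_in // dfwith_out // e // eq_sym.
Qed.

Definition flat_act (x y : obs) (s : step (fun i => funny (@C i)) x y) :
    hom flatC (flat_ob x) (flat_ob y) :=
  let: Step i m e := s in
  hom_cast flatC
    (congr1 flat_ob (dfwith_self (fun i' (_ : i' != i) => erefl (x i'))))
    (congr1 flat_ob (dfwith_self e))
    (block (E := fun a => dfwith x a) (@dfwith_in _ _ x i) (@dfwith_const x i) m).

Lemma flat_act_idn x i e :
  flat_act (@Step _ _ (fun i => funny (@C i)) x x i (idn (funny (@C i)) (x i)) e) =
    idn flatC (flat_ob x).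
Proof. by rewrite /flat_act block_idn hom_cast_id. Qed.

Lemma flat_act_cmp (x y z : obs) i
    (m : hom (funny (@C i)) (x i) (y i)) (n : hom (funny (@C i)) (y i) (z i))
    e e' e'' :
  cmp flatC (flat_act (Step m e)) (flat_act (Step n e')) =
    flat_act (@Step _ _ (fun i => funny (@C i)) x z i (cmp (funny (@C i)) m n) e'').
Proof.
rewrite /flat_act block_cmp.
rewrite (block_base (@dfwith_in _ _ x i) (@dfwith_const x i) _ _ (dfwith_base e) n).
rewrite hom_cast_cast hom_cast_cmp.
by congr (hom_cast _ _ _ _); apply: Prop_irrelevance.
Qed.

Definition flat_arr x y (m : hom (funny (fun i => funny (@C i))) x y) :
    hom flatC (flat_ob x) (flat_ob y) :=
  funny_rec (D := flatC) (F := flat_ob) flat_act m.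

Lemma flat_arr_idn x :
  flat_arr (idn (funny (fun i => funny (@C i))) x) = idn flatC (flat_ob x).
Proof. exact: (funny_rec_idn flat_act_idn flat_act_cmp). Qed.

Lemma flat_arr_cmp x y z (m : hom (funny (fun i => funny (@C i))) x y)
    (n : hom (funny (fun i => funny (@C i))) y z) :
  flat_arr (cmp (funny (fun i => funny (@C i))) m n) =
    cmp flatC (flat_arr m) (flat_arr n).
Proof. exact: (funny_rec_cmp flat_act_idn flat_act_cmp). Qed.

End FlattenCategory.

Definition funny_flatten (d : nat) (I : finType) (J : I -> finType)
    (X : forall i, J i -> gdisk d) :
  gdisk_map (gfunny (fun i => gfunny (X i)))
            (gfunny (fun u : {i & J i} => X (tag u) (tagged u))).
Proof.
refine (@GDiskMap d (gfunny (fun i => gfunny (X i)))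
  (gfunny (fun u : {i & J i} => X (tag u) (tagged u)))
  (fun k h x u => x (tag u) (tagged u))
  (fun k h y z m => flat_arr m) _ _ _ _ _).
- by [].
- by [].
- by [].
- by move=> k h x; apply: flat_arr_idn.
- by move=> k h x y z m n; apply: flat_arr_cmp.
Defined.

Record tree (d : nat) := Tree {
  node : forall k, k <= d -> finOrderType (Order.Disp tt tt);
  par : forall k (h : k < d), node h -> node (ltnW h);
  par_mono : forall k (h : k < d), {homo @par k h : x y / (x <= y)%O};
  root_singleton : #|node (leq0n d)| = 1 }.

Arguments node {d} t [k] h.
Arguments par {d} t [k] h y.

Section Disk.
Variables (d : nat) (T : tree d).

(* The external points of level k+1 are alpha(x) = (x, false) and
   beta(x) = (x, true) for x internal of level k, and alpha(x) = beta(x) = x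
   for x external of level k.                                                 *)
Fixpoint ext k : k <= d -> finType :=
  match k with
  | 0 => fun _ => void
  | k'.+1 => fun h => (node T (ltnW h) * bool + ext (ltnW h))%type
  end.

Definition dlev k (h : k <= d) : finType := (node T h + ext h)%type.

Definition ddn k (h : k < d) (y : dlev h) : dlev (ltnW h) :=
  match y with
  | inl y => inl (par T h y)
  | inr (inl (x, _)) => inl x
  | inr (inr e) => inr e
  end.

Definition dlo k (h : k < d) (x : dlev (ltnW h)) : dlev h :=
  match x with inl x => inr (inl (x, false)) | inr e => inr (inr e) end.

Definition dhi k (h : k < d) (x : dlev (ltnW h)) : dlev h :=
  match x with inl x => inr (inl (x, true)) | inr e => inr (inr e) end.

(* y <= z in a common fibre                                                   *)
Definition dle k (h : k < d) (y z : dlev h) : bool :=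
  (ddn y == ddn z) &&
  match y, z with
  | inl y, inl z => (y <= z)%O
  | inl _, inr (inl (_, b)) => b
  | inr (inl (_, b)), inl _ => ~~ b
  | inr (inl (_, b)), inr (inl (_, b')) => b ==> b'
  | _, _ => true
  end.

Lemma ddn_lo k (h : k < d) (x : dlev (ltnW h)) : ddn (dlo x) = x.
Proof. by case: x. Qed.

Lemma ddn_hi k (h : k < d) (x : dlev (ltnW h)) : ddn (dhi x) = x.
Proof. by case: x. Qed.

Lemma dle_refl k (h : k < d) (y : dlev h) : dle y y.
Proof. by rewrite /dle eqxx; case: y => [y|[[x b]|e]] //=; apply: implybb. Qed.

Lemma dle_dn k (h : k < d) (y z : dlev h) : dle y z -> ddn y = ddn z.
Proof. by case/andP => /eqP. Qed.

Lemma dle_trans k (h : k < d) (x y z : dlev h) : dle x y -> dle y z -> dle x z.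
Proof.
rewrite /dle => /andP[/eqP-> +] /andP[/eqP yz]; rewrite yz eqxx /=.
case: x y z yz => [x|[[x []]|x]] [y|[[y []]|y]] [z|[[z []]|z]] //= _.
exact: le_trans.
Qed.

Lemma dle_anti k (h : k < d) (y z : dlev h) : dle y z -> dle z y -> y = z.
Proof.
rewrite /dle => /andP[/eqP yz +] /andP[_].
case: y z yz => [y|[[y b]|y]] [z|[[z c]|z]] //=.
- by move=> _ yz zy; congr inl; apply: le_anti; rewrite yz.
- by case: c.
- by case: b.
- by case=> <-; case: b c => [] [].
- by case=> <-.
Qed.

Lemma dle_total k (h : k < d) (y z : dlev h) :
  ddn y = ddn z -> dle y z || dle z y.
Proof.
rewrite /dle => yz; rewrite yz eqxx /=; case: y z yz => [y|[[y b]|y]] [z|[[z c]|z]] //=.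
- by move=> _; apply: le_total.
- by case: c.
- by case: b.
- by case: b c => [] [].
Qed.

Lemma dlo_le k (h : k < d) (y : dlev h) : dle (dlo (ddn y)) y.
Proof. by rewrite /dle ddn_lo eqxx; case: y => [y|[[x b]|e]]. Qed.

Lemma dle_hi k (h : k < d) (y : dlev h) : dle y (dhi (ddn y)).
Proof. by rewrite /dle ddn_hi eqxx; case: y => [y|[[x b]|e]] //=; apply: implybT. Qed.

Lemma dlo_hi k (h : k < d) (x : dlev (ltnW h)) : dle (dlo x) (dhi x).
Proof. by have := dle_hi (dlo x); rewrite ddn_lo. Qed.

Definition darr k (h : k < d) : category (dlev h).
Proof.
refine (@Category (dlev h) (fun y z => dle y z) (@dle_refl k h)
  (fun x y z => @dle_trans k h x y z) _ _ _) => *; exact: bool_irrelevance.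
Defined.

Lemma darr_is_id k (h : k < d) (y z : dlev h) (f : hom (darr h) y z) :
  y = z -> is_id f.
Proof.
move=> yz; case: z / yz f => f.
by rewrite (bool_irrelevance f (idn (darr h) y)); apply: IsId.
Qed.

Lemma darr_dn k (h : k < d) (y z : dlev h) : hom (darr h) y z -> ddn y = ddn z.
Proof. exact: dle_dn. Qed.

Lemma dlo_lo k (h : k.+1 < d) (x : dlev (ltnW (ltnW h))) :
  dlo (dlo x) = dhi (dlo x) :> dlev h.
Proof. by case: x. Qed.

Lemma dlo_hi_ext k (h : k.+1 < d) (x : dlev (ltnW (ltnW h))) :
  dlo (dhi x) = dhi (dhi x) :> dlev h.
Proof. by case: x. Qed.

Lemma dlev0 : exists x : dlev (leq0n d), forall y, y = x.
Proof.
have [x xP] : exists x : node T (leq0n d), forall y, y = x.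
  have /eqP/card1P[x xP] := root_singleton T; exists x => y; apply/eqP.
  by rewrite -[_ == _]xP.
by exists (inl x) => -[y|[]]; rewrite (xP y).
Qed.

Lemma dfibre_eq k (h : k < d) x (y z : {y : dlev h | ddn y = x}) :
  sval y = sval z -> y = z.
Proof.
case: y z => y ey [z ez] /= yz; case: z / yz ez => ez.
by rewrite (Prop_irrelevance ez ey).
Qed.

Lemma ddegenerate k (h : k < d) (e : ext (ltnW h)) :
  terminal (fibre (darr h) (@ddn k h) (inr e)).
Proof.
exists (exist (fun y : dlev h => ddn y = inr e) (inr (inr e)) erefl).
split=> [[y ye]|f]; last exact: bool_irrelevance.
apply: dfibre_eq => /=; case: y ye => [y|[[y b]|e']] //=; by case=> ->.
Qed.

Lemma dinterval k (h : k < d) (x : dlev (ltnW h)) :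
  gen_interval (fibre (darr h) (@ddn k h) x)
    (exist _ (dlo x) (ddn_lo x)) (exist _ (dhi x) (ddn_hi x)).
Proof.
have lex (y : {y : dlev h | ddn y = x}) : dle (dlo x) (sval y).
  by have := dlo_le (sval y); rewrite (svalP y).
have xle (y : {y : dlev h | ddn y = x}) : dle (sval y) (dhi x).
  by have := dle_hi (sval y); rewrite (svalP y).
split.
- move=> y z; apply: (@rst_trans _ _ _ (exist _ (dlo x) (ddn_lo x))).
    by apply/rst_sym/rst_step; constructor; apply: lex.
  by apply/rst_step; constructor; apply: lex.
- split=> [y f|y my].
    by apply/full_is_idP/darr_is_id/(dle_anti f (lex y)).
  exact: (is_id_ob (my (exist _ (dlo x) (ddn_lo x)) (lex y))).
- split=> [y f|y my].
    by apply/full_is_idP/darr_is_id/(dle_anti f)/xle.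
  exact/esym/(is_id_ob (my (exist _ (dhi x) (ddn_hi x)) (xle y))).
- by case: x {lex xle} => [x /(congr1 sval)|e _] //; apply: ddegenerate.
Qed.

Lemma ddegenerate_lo k (h : k.+1 < d) (x : dlev (ltnW (ltnW h))) :
  terminal (fibre (darr h) (@ddn k.+1 h) (dlo x)).
Proof. by case: x => x; apply: ddegenerate. Qed.

Lemma ddegenerate_hi k (h : k.+1 < d) (x : dlev (ltnW (ltnW h))) :
  terminal (fibre (darr h) (@ddn k.+1 h) (dhi x)).
Proof. by case: x => x; apply: ddegenerate. Qed.

Definition disk : gdisk d :=
  @GDisk d (fun k h => dlev h) ddn dlo dhi darr ddn_lo ddn_hi dlo_lo dlo_hi_ext
    dlev0 darr_dn dinterval ddegenerate_lo ddegenerate_hi.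

End Disk.

Arguments ddn {d T} [k] h y.
Arguments dlo {d T} [k] h x.
Arguments dhi {d T} [k] h x.
Arguments dle {d T} [k] h y z.

(* Theta_d: the morphisms S -> T are the disk maps from the disk of T to the
   disk of S.                                                                 *)

Record theta (d : nat) (S T : tree d) := Theta {
  tfun : forall k (h : k <= d), dlev T h -> dlev S h;
  tfun_dn : forall k (h : k < d) (y : dlev T h), tfun (ddn h y) = ddn h (tfun y);
  tfun_lo : forall k (h : k < d) (x : dlev T (ltnW h)), tfun (dlo h x) = dlo h (tfun x);
  tfun_hi : forall k (h : k < d) (x : dlev T (ltnW h)), tfun (dhi h x) = dhi h (tfun x);
  tfun_le : forall k (h : k < d) (y z : dlev T h),
    dle h y z -> dle h (tfun y) (tfun z) }.

Arguments tfun {d S T} F [k] h y : rename.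

Definition theta_id (d : nat) (T : tree d) : theta T T :=
  @Theta d T T (fun k h y => y) (fun k h y => erefl) (fun k h x => erefl)
    (fun k h x => erefl) (fun k h y z yz => yz).

Definition theta_comp (d : nat) (S T U : tree d) (G : theta T U) (F : theta S T) :
  theta S U.
Proof.
refine (@Theta d S U (fun k h y => tfun F h (tfun G h y)) _ _ _ _) => *.
- by rewrite !tfun_dn.
- by rewrite !tfun_lo.
- by rewrite !tfun_hi.
- by do 2!apply: tfun_le.
Defined.

Definition theta_gdisk (d : nat) (S T : tree d) (F : theta S T) :
  gdisk_map (disk T) (disk S).
Proof.
refine (@GDiskMap d (disk T) (disk S) (tfun F)
  (fun k h y z => @tfun_le d S T F k h y z) _ _ _ _ _) => *.
- exact: tfun_dn.
- exact: tfun_lo.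
- exact: tfun_hi.
- exact: bool_irrelevance.
- exact: bool_irrelevance.
Defined.

(* Coloured symmetric operads.  A profile of n inputs is a function from 'I_n;
   the inputs of a composite are indexed by pairs of an input q of the outer
   operation and an input of the q-th inner one, in lexicographic order.      *)

Local Notation sig1 := tagnat.sig1.
Local Notation sig2 := tagnat.sig2.

Record operad_data (C : Type) := OperadData {
  ops :> forall n, ('I_n -> C) -> C -> Type;
  op_unit : forall T, ops (fun _ : 'I_1 => T) T;
  op_comp : forall n (S : 'I_n -> C) T (k : 'I_n -> nat) (U : forall q, 'I_(k q) -> C),
    ops S T -> (forall q, ops (U q) (S q)) ->
    ops (fun j : 'I_(\sum_q k q) => U (sig1 j) (sig2 j)) T;
  op_act : forall n (S : 'I_n -> C) T (s : {perm 'I_n}), ops S T -> ops (S \o s) T }.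

Arguments ops {C} P [n] S T : rename.
Arguments op_unit {C} P T : rename.
Arguments op_comp {C} P [n S T k U] w v : rename.
Arguments op_act {C} P [n S T] s w : rename.

(* Operations whose profiles are equal, but not by definition, are compared as
   elements of the set of all operations with a given output.                 *)
Definition total_op (C : Type) (P : operad_data C) (T : C) n (S : 'I_n -> C)
    (w : P n S T) : {n : nat & {S : 'I_n -> C & P n S T}} :=
  existT _ n (existT _ S w).

Section Perm.
Variables (n : nat) (k : 'I_n -> nat).

Lemma block_perm_sum (s : {perm 'I_n}) : \sum_q k q = \sum_q k (s q).
Proof. by rewrite (reindex_inj (@perm_inj _ s)). Qed.

(* Permutes blocks: the r-th input of the q-th block, the blocks being of sizes
   k (s q), goes to the r-th input of the block s q, the blocks being of sizes
   k q.                                                                       *)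
Definition block_perm_fun (s : {perm 'I_n}) (j : 'I_(\sum_q k q)) :
    'I_(\sum_q k q) :=
  let j' := cast_ord (block_perm_sum s) j in tagnat.Rank (s (sig1 j')) (sig2 j').

Lemma block_perm_inj s : injective (block_perm_fun s).
Proof.
move=> i j /eqP; rewrite -val_eqE tagnat.eq_Rank => /andP[/eqP/perm_inj e1 e2].
apply: (@cast_ord_inj _ _ (block_perm_sum s)); apply/eqP.
rewrite -[cast_ord _ i]tagnat.sig2K -[cast_ord _ j]tagnat.sig2K.
by rewrite -val_eqE tagnat.eq_Rank e2 andbT e1.
Qed.

Definition block_perm (s : {perm 'I_n}) : {perm 'I_(\sum_q k q)} :=
  perm (@block_perm_inj s).

Definition sum_perm_fun (t : forall q, {perm 'I_(k q)}) (j : 'I_(\sum_q k q)) :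
    'I_(\sum_q k q) := tagnat.Rank (sig1 j) (t (sig1 j) (sig2 j)).

Lemma sum_perm_inj t : injective (sum_perm_fun t).
Proof.
move=> i j /tagnat.rank_inj; rewrite /sig1 /sig2 => e; apply: tagnat.sig_inj.
case: (tagnat.sig i) (tagnat.sig j) e => [q p] [q' p'] /= e.
have qq' := congr1 tag e; rewrite /= in qq'; case: q' / qq' p' e => p' /eqP.
by rewrite eq_Tagged /= => /eqP/perm_inj ->.
Qed.

Definition sum_perm (t : forall q, {perm 'I_(k q)}) : {perm 'I_(\sum_q k q)} :=
  perm (@sum_perm_inj t).

End Perm.

(* In MathComp (s * t) x = t (s x), so op_act_mul says that the action is a
   right action for the usual composition of permutations.                    *)
Record symmetric_operad (C : Type) (P : operad_data C) : Prop := SymmetricOperad {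
  op_unitl : forall n (S : 'I_n -> C) T (w : P n S T),
    total_op (op_comp P (op_unit P T) (fun _ => w)) = total_op w;
  op_unitr : forall n (S : 'I_n -> C) T (w : P n S T),
    total_op (op_comp P w (fun q => op_unit P (S q))) = total_op w;
  op_assoc : forall n (S : 'I_n -> C) T
      (k : 'I_n -> nat) (U : forall q, 'I_(k q) -> C)
      (m : forall q, 'I_(k q) -> nat) (V : forall q p, 'I_(m q p) -> C)
      (w : P n S T) (v : forall q, P (k q) (U q) (S q))
      (u : forall q p, P (m q p) (V q p) (U q p)),
    total_op (op_comp P (op_comp P w v) (fun j => u (sig1 j) (sig2 j))) =
    total_op (op_comp P w (fun q => op_comp P (v q) (u q)));
  op_act_one : forall n (S : 'I_n -> C) T (w : P n S T),
    total_op (op_act P 1%g w) = total_op w;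
  op_act_mul : forall n (S : 'I_n -> C) T (s t : {perm 'I_n}) (w : P n S T),
    total_op (op_act P (s * t)%g w) = total_op (op_act P s (op_act P t w));
  op_comp_actl : forall n (S : 'I_n -> C) T
      (k : 'I_n -> nat) (U : forall q, 'I_(k q) -> C) (s : {perm 'I_n})
      (w : P n S T) (v : forall q, P (k q) (U q) (S q)),
    total_op (op_comp P (op_act P s w) (fun q => v (s q))) =
    total_op (op_act P (block_perm k s) (op_comp P w v));
  op_comp_actr : forall n (S : 'I_n -> C) T
      (k : 'I_n -> nat) (U : forall q, 'I_(k q) -> C)
      (t : forall q, {perm 'I_(k q)})
      (w : P n S T) (v : forall q, P (k q) (U q) (S q)),
    total_op (op_comp P w (fun q => op_act P (t q) (v q))) =
    total_op (op_act P (sum_perm t) (op_comp P w v)) }.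

Record symmetric_suboperad (C : Type) (P : operad_data C)
    (A : forall n (S : 'I_n -> C) T, P n S T -> Prop) : Prop := SymmetricSuboperad {
  sub_unit : forall T, A _ _ _ (op_unit P T);
  sub_comp : forall n (S : 'I_n -> C) T (k : 'I_n -> nat) (U : forall q, 'I_(k q) -> C)
      (w : P n S T) (v : forall q, P (k q) (U q) (S q)),
    A _ _ _ w -> (forall q, A _ _ _ (v q)) -> A _ _ _ (op_comp P w v);
  sub_act : forall n (S : 'I_n -> C) T (s : {perm 'I_n}) (w : P n S T),
    A _ _ _ w -> A _ _ _ (op_act P s w) }.

Definition lattice_path (d n : nat) (S : 'I_n -> tree d) (T : tree d) : Type :=
  gdisk_map (disk T) (gfunny (fun q => disk (S q))).

Definition theta_path (d : nat) (S T : tree d) (F : theta S T) :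
    lattice_path (fun _ : 'I_1 => S) T :=
  gdisk_comp (funny_unit (disk S)) (theta_gdisk F).

Definition lattice_comp (d n : nat) (S : 'I_n -> tree d) (T : tree d)
    (k : 'I_n -> nat) (U : forall q, 'I_(k q) -> tree d)
    (w : lattice_path S T) (v : forall q, lattice_path (U q) (S q)) :
    lattice_path (fun j : 'I_(\sum_q k q) => U (sig1 j) (sig2 j)) T :=
  gdisk_comp
    (funny_reindex (fun u : {q & 'I_(k q)} => disk (U (tag u) (tagged u)))
       tagnat.sigK tagnat.rankK)
    (gdisk_comp (funny_flatten (fun q p => disk (U q p)))
       (gdisk_comp (funny_map v) w)).

Definition lattice_act (d n : nat) (S : 'I_n -> tree d) (T : tree d)
    (s : {perm 'I_n}) (w : lattice_path S T) : lattice_path (S \o s) T :=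
  gdisk_comp (funny_reindex (fun q => disk (S q)) (permK s) (permKV s)) w.

Definition lattice_operad (d : nat) : operad_data (tree d) :=
  @OperadData (tree d) (@lattice_path d) (fun T => theta_path (theta_id T))
    (@lattice_comp d) (@lattice_act d).

(* The category of unary operations of P is Theta_d.                          *)
Record theta_coloured (d : nat) (P : operad_data (tree d))
    (phi : forall S T, theta S T -> P 1 (fun _ => S) T) : Prop := ThetaColoured {
  unary_bij : forall S T, bijective (@phi S T);
  unary_id : forall T, phi T T (theta_id T) = op_unit P T;
  unary_comp : forall S T U (G : theta T U) (F : theta S T),
    total_op (phi S U (theta_comp G F)) =
    total_op (op_comp P (phi T U G) (fun _ => phi S T F)) }.

Section Complexity.
Variables (d n : nat) (S : 'I_n -> tree d) (T : tree d).

(* The arrow y -> z of a linear order is composed of as many unit steps as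
   there are points in the interval ]y, z].                                   *)
Definition dist (U : tree d) k (h : k < d) (y z : dlev U h) : nat :=
  #|[set u : dlev U h | [&& dle h y u, dle h u z & u != y]]|.

Definition step_word k (h : k < d) (x y : forall q, dlev (S q) h)
    (s : step (fun q => arr (disk (S q)) h) x y) : seq 'I_n :=
  let: Step q _ _ := s in nseq (dist (x q) (y q)) q.

Fixpoint walk_word k (h : k < d) (x y : forall q, dlev (S q) h)
    (p : walk (fun q => arr (disk (S q)) h) x y) : seq 'I_n :=
  match p with
  | wnil _ => [::]
  | wcons _ _ _ s p' => step_word s ++ walk_word p'
  end.

Lemma dist_refl (U : tree d) k (h : k < d) (y : dlev U h) : dist y y = 0.
Proof.
apply: eq_card0 => u; rewrite inE; apply/negP => /and3P[yu uy /eqP[]].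
exact: dle_anti.
Qed.

Lemma dist_add (U : tree d) k (h : k < d) (x y z : dlev U h) :
  dle h x y -> dle h y z -> dist x z = dist x y + dist y z.
Proof.
move=> xy yz; rewrite /dist.
set A := [set u | [&& dle h x u, dle h u y & u != x]].
set B := [set u | [&& dle h y u, dle h u z & u != y]].
have AB0 : A :&: B = set0.
  apply/setP => u; rewrite !inE; apply/negP => /andP[/and3P[_ uy _] /and3P[yu _]].
  by rewrite (dle_anti uy yu) eqxx.
rewrite -cardsUI AB0 cards0 addn0; congr #|pred_of_set _|; apply/setP => u.
rewrite !inE; apply/and3P/orP => [[xu uz ux]|[|] /and3P[a b c]].
- have [uy|uy] := eqVneq u y; first by left; rewrite xu uy dle_refl -uy.
  have /orP[le|le] := dle_total (etrans (esym (dle_dn xu)) (dle_dn xy)).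
    by left; rewrite xu le.
  by right; rewrite le uz.
- by split=> //; apply: dle_trans b yz.
- split=> //; first exact: dle_trans xy a.
  by apply: contra c => /eqP ux; rewrite ux in a *; rewrite (dle_anti a xy).
Qed.

Lemma walk_word_eq k (h : k < d) (x y : forall q, dlev (S q) h)
    (p q : walk (fun q => arr (disk (S q)) h) x y) :
  walk_eq p q -> walk_word p = walk_word q.
Proof.
elim=> {x y p q} //=.
- by move=> x y p q r _ -> _ ->.
- by move=> x y z s p q _ ->.
- by move=> x y i e p; rewrite dist_refl.
- move=> x y z t i f g e e' e'' p.
  by rewrite catA -nseqD -dist_add.
Qed.

(* The word of an arrow is that of any walk representing it.                  *)
Definition hom_word k (h : k < d) (x y : forall q, dlev (S q) h)
    (m : hom (arr (gfunny (fun q => disk (S q))) h) x y) : seq 'I_n :=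
  walk_word (wrepr m).

Lemma hom_word_class k (h : k < d) (x y : forall q, dlev (S q) h)
    (p : walk (fun q => arr (disk (S q)) h) x y) :
  hom_word (wclass p) = walk_word p.
Proof. exact/walk_word_eq/wrepr_class. Qed.

Definition changes (A : eqType) (w : seq A) : nat :=
  if w is x :: w' then count id (pairmap (fun y z => y != z) x w') else 0.

(* The word of the image of min -> max in the fibre over the internal point a
   of level k, which lies in level k + 1.                                     *)
Definition path_word (w : lattice_path S T) k (h : k < d) (a : node T (ltnW h)) :
    seq 'I_n :=
  hom_word (garr w h (dlo_hi (inl a : dlev T (ltnW h)))).

Definition level_complexity (w : lattice_path S T) k (h : k < d) : nat :=
  \max_(a : node T (ltnW h)) \max_(i < n) \max_(j < n | i < j)
    changes [seq r <- path_word w a | (r == i) || (r == j)].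

(* The components are numbered from 0: the l-th one is c_(l+1).               *)
Definition total_complexity (w : lattice_path S T) : 'I_d -> nat :=
  fun l => level_complexity w (ltn_ord l).

Definition complexity_le (c : 'I_d -> nat) (w : lattice_path S T) : Prop :=
  forall l, total_complexity w l <= c l.

End Complexity.

(* Main.v *)
Require Import Defs.
From mathcomp Require Import all_boot all_order all_fingroup.
From mathcomp Require Import boolp.

Set Implicit Arguments.
Unset Strict Implicit.
Unset Printing Implicit Defensive.

Import Order.TTheory.

Local Notation sig1 := tagnat.sig1.
Local Notation sig2 := tagnat.sig2.
Local Notation Rank := tagnat.Rank.

(** Why the operad laws hold.  A finite linear order is the free category on its
    unit steps, so an arrow of a funny product of disks is determined by its
    source, its target and its word ([hom_word_inj]).  Hence a lattice path is
    determined by its values on points and the words of its arrows, and two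
    operations whose profiles agree position by position are equal as soon as
    their points and their words agree ([total_path_eq]).  The points of a
    composite are composites of functions, so only words need work.

    Taking words is a functor to a free monoid, here called a weight.  By the
    universal property of the funny product, a weight on each factor extends
    uniquely to the product ([funny_weight], [funny_weight_unique]), so that
    its pullback along each of the maps which composition and the symmetric
    action are built from is found by looking at single steps.  The outcome for
    composition ([weight_lattice_comp], [comp_word]) is substitution: in the
    word of w, a step f in direction q is replaced with the word of v q on f,
    whose letter p is renamed to the position Rank q p of that input in the
    composite.  Each law thus reduces to an identity between positions in
    lexicographic order.

    A unary lattice path is determined by its points, since its words are powers
    of a single letter ([unary_word]); this gives the part about Theta_d.

    Why complexity does not grow.  Keep two letters, at inputs in the blocks q
    and q', of the word of a composite over an internal point.  If q = q', only
    the steps of w in direction q contribute; they compose to an arrow from the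
    minimum to the maximum of a fibre, so that what is left is a projection of a
    path word of v q, or is empty if the fibre is degenerate
    ([changes_same_block]).  If q and q' differ, a step in direction q yields a
    power of one letter, which is empty if the step is an identity, and there
    are no more changes than in the (q, q')-projection of the word of w
    ([changes_distinct_blocks]).  The symmetric action renames letters
    injectively. *)

(** * Weights on funny products *)

(** Functors from C to the free monoid on L, seen as a category with one object. *)
Record weight (O : Type) (C : category O) (L : Type) := Weight {
  wt :> forall x y, hom C x y -> seq L;
  wt_idn : forall x, wt (idn C x) = [::];
  wt_cmp : forall x y z (f : hom C x y) (g : hom C y z),
    wt (cmp C f g) = wt f ++ wt g }.

Arguments wt {O C L} a [x y] f : rename.

Lemma wt_cast O (C : category O) L (a : weight C L) x x' y y' (ex : x = x')
    (ey : y = y') (f : hom C x y) :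
  wt a (hom_cast C ex ey f) = wt a f.
Proof. by case: _ / ex; case: _ / ey. Qed.

Section FunnyWeight.
Variables (I : finType) (O : I -> Type) (C : forall i, category (O i)) (L : Type).
Variable a : forall i, weight (C i) L.

Definition step_weight x y (s : step C x y) : seq L :=
  let: Step i f _ := s in wt (a i) f.

Fixpoint walk_weight x y (p : walk C x y) : seq L :=
  match p with
  | wnil _ => [::]
  | wcons _ _ _ s p' => step_weight s ++ walk_weight p'
  end.

Lemma walk_weight_eq x y (p q : walk C x y) :
  walk_eq p q -> walk_weight p = walk_weight q.
Proof.
elim=> {x y p q} //=.
- by move=> x y p q r _ -> _ ->.
- by move=> x y z s p q _ ->.
- by move=> x y i e p; rewrite wt_idn.
- by move=> x y z t i f g e e' e'' p; rewrite wt_cmp catA.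
Qed.

Lemma walk_weight_cat x y z (p : walk C x y) (q : walk C y z) :
  walk_weight (wcat p q) = walk_weight p ++ walk_weight q.
Proof. by elim: p q => //= u v w s p IH q; rewrite IH catA. Qed.

Let funny_wt x y (m : hom (funny C) x y) : seq L := walk_weight (wrepr m).

Let funny_wt_class x y (p : walk C x y) : funny_wt (wclass p) = walk_weight p.
Proof. exact/walk_weight_eq/wrepr_class. Qed.

Definition funny_weight : weight (funny C) L.
Proof.
refine (@Weight _ (funny C) L funny_wt _ _).
- by move=> x; apply: funny_wt_class.
- move=> x y z m n; rewrite /= -{1}(wreprK m) -{1}(wreprK n) funny_cmp_class.
  by rewrite funny_wt_class walk_weight_cat.
Defined.

Lemma funny_weight_class x y (p : walk C x y) :
  wt funny_weight (wclass p) = walk_weight p.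
Proof. exact: funny_wt_class. Qed.

Lemma funny_weight_gen x y (s : step C x y) :
  wt funny_weight (gen s) = step_weight s.
Proof. by rewrite funny_weight_class /= cats0. Qed.

End FunnyWeight.

(** The uniqueness part of the universal property of the funny product: it
    reduces the computation of a pulled back weight to that on generators. *)
Lemma funny_weight_unique (I : finType) (O : I -> Type) (C : forall i, category (O i))
    L (a : forall i, weight (C i) L) (b : weight (funny C) L) :
  (forall x y (s : step C x y), wt b (gen s) = step_weight a s) ->
  forall x y (m : hom (funny C) x y), wt b m = wt (funny_weight a) m.
Proof.
move=> ab x y m; rewrite -(wreprK m); elim: (wrepr m) => {x y m} [x|x y z s p IH].
  by rewrite funny_weight_class; apply: wt_idn.
by rewrite wclass_cons !wt_cmp IH ab funny_weight_gen.
Qed.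

(** When only the q-th weight is non-trivial, the steps in direction q of a walk
    can be composed, as the other steps leave the q-th coordinate unchanged. *)
Lemma funny_weight_single (I : finType) (O : I -> Type) (C : forall i, category (O i))
    L (a : forall i, weight (C i) L) q :
  (forall i x y (f : hom (C i) x y), i != q -> wt (a i) f = [::]) ->
  forall x y (m : hom (funny C) x y), exists f : hom (C q) (x q) (y q),
    wt (funny_weight a) m = wt (a q) f.
Proof.
move=> a0 x y m; rewrite -(wreprK m) funny_weight_class.
elim: (wrepr m) => {x y m} [x|x y z [i f e] p [g IH]] /=.
  by exists (idn (C q) (x q)); rewrite wt_idn.
rewrite IH; have [iq|iq] := eqVneq i q.
  case: q / iq {a0} g IH => g IH; exists (cmp (C i) f g); by rewrite wt_cmp.
have yx : y q = x q by rewrite e // eq_sym.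
by exists (hom_cast (C q) yx erefl g); rewrite wt_cast a0.
Qed.

Lemma eq_funny_weight (I : finType) (O : I -> Type) (C : forall i, category (O i))
    L (a b : forall i, weight (C i) L) :
  (forall i x y (f : hom (C i) x y), wt (a i) f = wt (b i) f) ->
  forall x y (m : hom (funny C) x y),
    wt (funny_weight a) m = wt (funny_weight b) m.
Proof.
move=> ab; apply: funny_weight_unique => x y s.
by rewrite funny_weight_gen; case: s => i f e /=; rewrite ab.
Qed.

Section Morphism.
Variables (L L' : Type) (g : seq L -> seq L').
Hypotheses (g_nil : g [::] = [::]) (g_cat : forall s t, g (s ++ t) = g s ++ g t).

Definition image_weight (O : Type) (C : category O) (a : weight C L) : weight C L'.
Proof.
refine (@Weight _ C L' (fun x y f => g (wt a f)) _ _).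
- by move=> x; rewrite wt_idn.
- by move=> x y z f f'; rewrite wt_cmp.
Defined.

(** A monoid morphism, such as a renaming or an erasure of letters, may be
    applied factor by factor. *)
Lemma morph_funny_weight (I : finType) (O : I -> Type) (C : forall i, category (O i))
    (a : forall i, weight (C i) L) (b : forall i, weight (C i) L') :
  (forall i x y (f : hom (C i) x y), g (wt (a i) f) = wt (b i) f) ->
  forall x y (m : hom (funny C) x y),
    g (wt (funny_weight a) m) = wt (funny_weight b) m.
Proof.
move=> ab x y m.
rewrite -[LHS]/(wt (image_weight (funny_weight a)) m).
apply: funny_weight_unique => {m}x {}y s.
rewrite -[LHS]/(g (wt (funny_weight a) _)) funny_weight_gen.
by case: s => i f e; apply: ab.
Qed.

End Morphism.

Section PullWeight.
Variables (O O' : Type) (C : category O) (D : category O') (F : O -> O').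
Variable G : forall x y, hom C x y -> hom D (F x) (F y).
Hypothesis G_idn : forall x, G (idn C x) = idn D (F x).
Hypothesis G_cmp : forall x y z (f : hom C x y) (g : hom C y z),
  G (cmp C f g) = cmp D (G f) (G g).
Variables (L : Type) (a : weight D L).

Definition pull_weight : weight C L.
Proof.
refine (@Weight _ _ L (fun x y f => wt a (G f)) _ _).
- by move=> x; rewrite G_idn wt_idn.
- by move=> x y z f g; rewrite G_cmp wt_cmp.
Defined.

Lemma pull_weightE x y (f : hom C x y) : wt pull_weight f = wt a (G f).
Proof. by []. Qed.

End PullWeight.

Definition garr_weight d (X Y : gdisk d) (F : gdisk_map X Y) k (h : k < d) L
    (a : weight (arr Y h) L) : weight (arr X h) L :=
  pull_weight (@garr_idn d X Y F k h) (@garr_cmp d X Y F k h) a.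

Lemma weight_funny_map d (I : finType) (X Y : I -> gdisk d)
    (F : forall i, gdisk_map (X i) (Y i)) k (h : k < d) L
    (a : forall i, weight (arr (Y i) h) L) x y (m : hom (arr (gfunny X) h) x y) :
  wt (funny_weight a) (garr (funny_map F) h m) =
    wt (funny_weight (fun i => garr_weight (F i) (a i))) m.
Proof.
rewrite -[LHS]/(wt (garr_weight (funny_map F) (funny_weight a)) m).
apply: funny_weight_unique => {m}x {}y s.
rewrite pull_weightE [garr _ _ _]funny_rec_gen;
  [|exact: fmap_act_idn|exact: fmap_act_cmp].
by case: s => i f e; apply: funny_weight_gen.
Qed.

(** Reindexing sends a step in direction i to one in direction v i, whose arrow
    lives over u (v i); b i describes its weight without this transport. *)
Lemma weight_funny_reindex d (I J : finType) (X : I -> gdisk d) (u : J -> I)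
    (v : I -> J) (uK : cancel u v) (vK : cancel v u) k (h : k < d) L
    (a : forall j, weight (arr (X (u j)) h) L) (b : forall i, weight (arr (X i) h) L) :
  (forall j x y (f : hom (arr (X (u j)) h) x y), wt (a j) f = wt (b (u j)) f) ->
  forall x y (m : hom (arr (gfunny X) h) x y),
  wt (funny_weight a) (garr (funny_reindex X uK vK) h m) = wt (funny_weight b) m.
Proof.
move=> ab x y m.
rewrite -[LHS]/(wt (garr_weight (funny_reindex X uK vK) (funny_weight a)) m).
apply: funny_weight_unique => {m}x {}y s.
rewrite pull_weightE [garr _ _ _]funny_rec_gen;
  [|exact: reindex_act_idn|exact: reindex_act_cmp].
case: s => i f e; apply: etrans (funny_weight_gen _ _) _ => /=.
by rewrite ab /reindex_ob; case: _ / (esym (vK i)).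
Qed.

Lemma weight_flat_arr (I : finType) (J : I -> finType) (O : forall i, J i -> Type)
    (C : forall i (j : J i), category (O i j)) L
    (a : forall u : {i & J i}, weight (C (tag u) (tagged u)) L)
    x y (m : hom (funny (fun i => funny (@C i))) x y) :
  wt (funny_weight a) (flat_arr m) =
  wt (funny_weight (fun i => funny_weight
       (fun j => a (Tagged (fun i => J i) j)))) m.
Proof.
rewrite -[LHS]/(wt (pull_weight (@flat_arr_idn _ _ _ C) (@flat_arr_cmp _ _ _ C)
  (funny_weight a)) m).
apply: funny_weight_unique => {m}x {}y s.
rewrite pull_weightE [flat_arr _]funny_rec_gen;
  [|exact: flat_act_idn|exact: flat_act_cmp].
case: s => i m e; rewrite /flat_act wt_cast.
set Ein := @dfwith_in _ _ x i; set Eout := @dfwith_const _ _ _ x i.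
rewrite -[LHS]/(wt (pull_weight (@block_idn _ _ _ C _ _ Ein Eout)
  (@block_cmp _ _ _ C _ _ Ein Eout)
  (funny_weight a)) m).
apply: funny_weight_unique => {m e}p q t.
rewrite pull_weightE [block _ _ _]funny_rec_gen;
  [|exact: block_act_idn|exact: block_act_cmp].
by case: t => j f e; rewrite /block_act funny_weight_gen /= wt_cast.
Qed.

(** * Words of lattice paths *)

Section DistWeight.
Variables (d : nat) (T : tree d) (k : nat) (h : k < d).

Definition dist_weight L (l : L) : weight (arr (disk T) h) L.
Proof.
refine (@Weight _ (arr (disk T) h) L (fun y z _ => nseq (dist y z) l) _ _).
- by move=> x; rewrite dist_refl.
- by move=> x y z f g; rewrite (dist_add f g) nseqD.
Defined.

Lemma dist0 (y z : dlev T h) : dle h y z -> dist y z = 0 -> y = z.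
Proof.
move=> yz /eqP; rewrite cards_eq0 => /eqP e; apply/eqP; apply: contraT => ne.
by have := in_set0 z; rewrite -e inE yz dle_refl eq_sym ne.
Qed.

End DistWeight.

Definition label_weight d n (S : 'I_n -> tree d) L (l : 'I_n -> L) k (h : k < d) :
    weight (arr (gfunny (fun q => disk (S q))) h) L :=
  funny_weight (fun q => @dist_weight d (S q) k h L (l q)).

(** Words with renamed letters are weights, which makes the computations of
    pulled back weights available for them. *)
Lemma map_hom_word d n (S : 'I_n -> tree d) L (l : 'I_n -> L) k (h : k < d) x y
    (m : hom (arr (gfunny (fun q => disk (S q))) h) x y) :
  map l (hom_word m) = wt (label_weight S l h) m.
Proof.
have -> : hom_word m = wt (label_weight S id h) m.
  rewrite /hom_word -{2}(wreprK m) funny_weight_class.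
  by elim: (wrepr m) => //= u v w [q f e] p ->.
apply: (@morph_funny_weight _ _ (map l) erefl (map_cat l)) => q u v f /=.
exact: map_nseq.
Qed.

(** A step of w in direction q acts in the composite through v q.  The weights a
    are indexed by positions and b by pairs: only the latter do not involve
    transport along the bijection between pairs and positions. *)
Lemma weight_lattice_comp d n (S : 'I_n -> tree d) (T : tree d) (k : 'I_n -> nat)
    (U : forall q, 'I_(k q) -> tree d) (w : lattice_path S T)
    (v : forall q, lattice_path (U q) (S q)) l (h : l < d) L
    (a : forall j : 'I_(\sum_q k q), weight (arr (disk (U (sig1 j) (sig2 j))) h) L)
    (b : forall q p, weight (arr (disk (U q p)) h) L) :
  (forall j x y (f : hom (arr (disk (U (sig1 j) (sig2 j))) h) x y),
     wt (a j) f = wt (b (sig1 j) (sig2 j)) f) ->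
  forall x y (f : hom (arr (disk T) h) x y),
    wt (funny_weight a) (garr (lattice_comp w v) h f) =
    wt (funny_weight (fun q => garr_weight (v q) (funny_weight (b q)))) (garr w h f).
Proof.
move=> ab x y f; pose c (u : {q & 'I_(k q)}) := b (tag u) (tagged u).
have /weight_funny_reindex e :
  forall j x y g, wt (a j) g = @wt _ _ _ (c (tagnat.sig j)) x y g by exact: ab.
by rewrite [LHS]e -weight_funny_map; apply: (@weight_flat_arr _ _ _ _ _ c).
Qed.

(** * Lattice paths are determined by points and words *)

Section Faithful.
Variables (d n : nat) (S : 'I_n -> tree d) (k : nat) (h : k < d).
Local Notation C := (fun q => arr (disk (S q)) h).
Implicit Types x y z : forall q, dlev (S q) h.

Fixpoint walk_size x y (p : walk C x y) : nat :=
  if p is wcons _ _ _ _ p' then (walk_size p').+1 else 0.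

Lemma step_word_nil x y (s : step C x y) : step_word s = [::] -> is_id (gen s).
Proof.
case: s => q f e /= /(congr1 size); rewrite size_nseq => f0.
exact/gen_is_id/darr_is_id/(dist0 f).
Qed.

Lemma walk_word_nil x y (p : walk C x y) :
  walk_word p = [::] -> is_id (C := funny C) (wclass p).
Proof.
elim: p => {x y} [x _|x y z s p IH /= sp]; first exact: (IsId (funny C)).
have [s0 p0] : step_word s = [::] /\ walk_word p = [::].
  by case: (step_word s) sp.
rewrite wclass_cons; move: (gen s) (step_word_nil s0) => t ids {s s0 sp}.
by case: y t / ids p p0 IH => p p0 IH; rewrite idn_cmp; apply: IH.
Qed.

Lemma dist_le (U : tree d) (x y z : dlev U h) :
  dle h x y -> dle h x z -> dist x y <= dist x z -> dle h y z.
Proof.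
move=> xy xz le; have /orP[//|zy] := dle_total (etrans (esym (dle_dn xy)) (dle_dn xz)).
move: le; rewrite (dist_add xz zy) -[leqRHS]addn0 leq_add2l leqn0 => /eqP/(dist0 zy) ->.
exact: dle_refl.
Qed.

(** Of two steps in the same direction from the same point, the longer one factors
    through the shorter one, because fibres are linearly ordered. *)
Lemma walk_factor x y y' z i (f : hom (C i) (x i) (y i)) e
    (g : hom (C i) (x i) (y' i)) e' (q : walk C y' z) :
  dist (x i) (y i) <= dist (x i) (y' i) ->
  exists r : walk C y z,
    [/\ wclass (wcons (Step g e') q) = wclass (wcons (Step f e) r),
        walk_word (wcons (Step g e') q) = walk_word (wcons (Step f e) r)
      & walk_size r = (walk_size q).+1].
Proof.
move=> fg; have g' : hom (C i) (y i) (y' i) := dist_le f g fg.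
have e'' j : j != i -> y j = y' j by move=> ji; rewrite -e // e'.
exists (wcons (Step g' e'') q); split=> //; last first.
  by rewrite /= catA -nseqD -(dist_add f g').
by apply/wclass_eq/weq_sym; rewrite (bool_irrelevance g (cmp (C i) f g')); apply: weq_cmp.
Qed.

(** Induction on the total number of steps.  Steps of length zero are identities
    and may be dropped.  Otherwise equal words force the first steps of both
    walks to have the same direction; after factoring the longer of the two, the
    common first step can be cancelled. *)
Lemma walk_word_inj x y (p q : walk C x y) :
  walk_word p = walk_word q -> wclass p = wclass q.
Proof.
have [N] := ubnP (walk_size p + walk_size q); elim: N x y p q => // N IH x y p.
case: p => {x y} [x q _ /esym/walk_word_nil e|x y z s p q].
  by rewrite [RHS](is_id_eq erefl e).
case s0: (step_word s) => [|i sw].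
  rewrite wclass_cons [walk_word _]/= [walk_size _]/= s0.
  move: (gen s) (step_word_nil s0) => t ids {s s0}.
  by case: y t / ids p => p lt; rewrite idn_cmp; apply: IH.
rewrite ltnS; case: q s s0 p => {x z} [x s _ p _ e|x y' z t q s s0 p].
  by rewrite [LHS](is_id_eq erefl (walk_word_nil e)).
case t0: (step_word t) => [|j tw].
  rewrite [wclass (wcons t q)]wclass_cons [walk_word (wcons t q)]/=
    [walk_size (wcons t q)]/= t0.
  move: (gen t) (step_word_nil t0) => r idr {t t0}.
  case: y' r / idr q => q lt; rewrite idn_cmp; apply: IH.
  by apply: leq_trans lt; rewrite addnS.
case: s t s0 t0 => [a f e] [b g e'] s0 t0 sz w.
(* a non-empty step word is a power of its direction *)
have ab : a = b.
  move: w; rewrite /= -[nseq _ a]/(step_word (Step f e)) s0.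
  rewrite -[nseq _ b]/(step_word (Step g e')) t0 => -[ij _].
  have := mem_head i sw; rewrite -s0 mem_nseq => /andP[_ /eqP <-].
  by have := mem_head j tw; rewrite -t0 mem_nseq => /andP[_ /eqP <-].
case: b / ab g e' t0 w sz => g e' _ w sz {i sw j tw s0}.
have [fg|/ltnW gf] := leqP (dist (x a) (y a)) (dist (x a) (y' a)).
  have [r [-> wr sr]] := walk_factor f e g e' q fg.
  rewrite !wclass_cons; apply: (congr1 (cmp (funny C) _)); apply: IH; first by rewrite sr.
  by move: w; rewrite wr /= => /eqP; rewrite eqseq_cat // eqxx => /eqP.
have [r [-> wr sr]] := walk_factor g e' f e p gf.
rewrite !wclass_cons; apply: (congr1 (cmp (funny C) _)); apply: IH.
  by move: sz; rewrite sr /= addnS addSn.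
by move: w; rewrite wr /= => /eqP; rewrite eqseq_cat // eqxx => /eqP.
Qed.

Lemma hom_word_inj x y (m m' : hom (arr (gfunny (fun q => disk (S q))) h) x y) :
  hom_word m = hom_word m' -> m = m'.
Proof. by rewrite -(wreprK m) -(wreprK m') !hom_word_class => /walk_word_inj. Qed.

End Faithful.

Lemma lattice_path_eq d n (S : 'I_n -> tree d) (T : tree d) (w w' : lattice_path S T) :
  (forall k (h : k <= d) (x : dlev T h) q, gfun w h x q = gfun w' h x q) ->
  (forall k (h : k < d) (x y : dlev T h) (f : hom (arr (disk T) h) x y),
     hom_word (garr w h f) = hom_word (garr w' h f)) ->
  w = w'.
Proof.
case: w w' => [u a p1 p2 p3 p4 p5] [u' a' p1' p2' p3' p4' p5'] /= uu' aa'.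
have eu : u = u'.
  do 4![apply: functional_extensionality_dep => ?]; exact: uu'.
case: u' / eu a' p1' p2' p3' p4' p5' aa' {uu'} => a' p1' p2' p3' p4' p5' aa'.
have ea : a = a'.
  do 5![apply: functional_extensionality_dep => ?]; exact/hom_word_inj/aa'.
case: a' / ea p4' p5' {aa'} => p4' p5'.
by congr GDiskMap; apply: Prop_irrelevance.
Qed.

Lemma existT_inj A (P : A -> Type) a (x y : P a) :
  existT P a x = existT P a y -> x = y.
Proof.
move=> xy.
have rect (u v : {a & P a}) (e : u = v) :
  eq_rect _ P (projT2 u) _ (congr1 (@projT1 _ _) e) = projT2 v by case: v / e.
have := rect _ _ xy; move: (congr1 _ xy) => /= e.
by rewrite (Prop_irrelevance e erefl).
Qed.

(** The profiles are compared together with the points: at level 0 the disk of T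
    has a point, so that equality of the dependent pairs gives S q = S' q'.
    Letters are compared as numbers, since they live in different ordinals. *)
Lemma total_path_eq d (T : tree d) n (S : 'I_n -> tree d) (w : lattice_path S T)
    n' (S' : 'I_n' -> tree d) (w' : lattice_path S' T) :
  n = n' ->
  (forall q, exists2 q', val q' = val q &
     forall k (h : k <= d) (x : dlev T h),
       existT (fun U => dlev U h) (S q) (gfun w h x q) =
       existT (fun U => dlev U h) (S' q') (gfun w' h x q')) ->
  (forall k (h : k < d) (x y : dlev T h) (f : hom (arr (disk T) h) x y),
     map val (hom_word (garr w h f)) = map val (hom_word (garr w' h f))) ->
  total_op (P := lattice_operad d) w = total_op (P := lattice_operad d) w'.
Proof.
move=> en; case: n' / en S' w' => S' w' E W.
have {}E q : forall k (h : k <= d) (x : dlev T h),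
       existT (fun U => dlev U h) (S q) (gfun w h x q) =
       existT (fun U => dlev U h) (S' q) (gfun w' h x q).
  by have [q' /val_inj ->] := E q.
have eS : S = S'.
  apply: functional_extensionality_dep => q; have [x _] := dlev0 T.
  exact: (congr1 (@projT1 _ _) (E q _ _ x)).
case: S' / eS w' E W => w' E W; congr total_op.
apply: lattice_path_eq => [k h x q|k h x y f]; first exact: (existT_inj (E q k h x)).
exact/(inj_map val_inj)/W.
Qed.

(** * Points and words of operations *)

Lemma weight_theta_path d (S T : tree d) (F : theta S T) k (h : k < d) L
    (a : 'I_1 -> weight (arr (disk S) h) L) x y (f : hom (arr (disk T) h) x y) :
  wt (funny_weight a) (garr (theta_path F) h f) = wt (a ord0) (garr (theta_gdisk F) h f).
Proof. exact: funny_weight_gen. Qed.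

Lemma eq_label_weight d n (S : 'I_n -> tree d) L (l l' : 'I_n -> L) k (h : k < d) x y
    (m : hom (arr (gfunny (fun q => disk (S q))) h) x y) :
  l =1 l' -> wt (label_weight S l h) m = wt (label_weight S l' h) m.
Proof. by move=> ll'; apply: eq_funny_weight => q u v f; rewrite /= ll'. Qed.

Section Operations.
Variables (d n : nat) (S : 'I_n -> tree d) (T : tree d) (w : lattice_path S T).

(** Input q of the permuted operation is input s q of w, so a step in direction
    r becomes one in direction s^-1 r. *)
Lemma act_word (s : {perm 'I_n}) L (l : 'I_n -> L) k (h : k < d) x y
    (f : hom (arr (disk T) h) x y) :
  map l (hom_word (garr (lattice_act s w) h f)) =
  wt (label_weight S (l \o (s^-1)%g) h) (garr w h f).
Proof.
rewrite map_hom_word.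
by apply: weight_funny_reindex => j u v g /=; rewrite permK.
Qed.

Variables (k : 'I_n -> nat) (U : forall q, 'I_(k q) -> tree d).
Arguments U : clear implicits.
Variable v : forall q, lattice_path (U q) (S q).

Lemma comp_word L (l : 'I_(\sum_q k q) -> L) i (h : i < d) x y
    (f : hom (arr (disk T) h) x y) :
  map l (hom_word (garr (lattice_comp w v) h f)) =
  wt (funny_weight
        (fun q => garr_weight (v q) (label_weight (U q) (fun p => l (Rank q p)) h)))
     (garr w h f).
Proof.
rewrite map_hom_word.
pose b q p := dist_weight (U q p) h (l (Rank q p)).
by apply: (@weight_lattice_comp _ _ _ _ _ _ _ _ _ _ _ _ b) => j u t g;
  rewrite /= tagnat.sig2K.
Qed.

(** The profile at the position Rank q p is U q p only up to transport, whence
    the dependent pairs. *)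
Lemma comp_point q (p : 'I_(k q)) i (h : i <= d) (x : dlev T h) :
  existT (fun U => dlev U h) (U (sig1 (Rank q p)) (sig2 (Rank q p)))
    (gfun (lattice_comp w v) h x (Rank q p)) =
  existT (fun U => dlev U h) (U q p) (gfun (v q) h (gfun w h x q) p).
Proof.
pose F (u : {q & 'I_(k q)}) := existT (fun U => dlev U h) (U (tag u) (tagged u))
  (gfun (v (tag u)) h (gfun w h x (tag u)) (tagged u)).
exact: (congr1 F (tagnat.rankK (Tagged _ p))).
Qed.

End Operations.

(** * The laws of a symmetric operad *)

Section RankSum.
Variables (n : nat) (k : 'I_n -> nat) (F : forall q, 'I_(k q) -> nat).
Arguments F : clear implicits.

Lemma sum_Rank (Q : pred 'I_(\sum_q k q)) :
  \sum_(j | Q j) F (sig1 j) (sig2 j) = \sum_q \sum_(p | Q (Rank q p)) F q p.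
Proof.
rewrite sig_big_dep (reindex _ (onW_bij _ tagnat.rank_bij)).
pose G (u : {q & 'I_(k q)}) := F (tag u) (tagged u).
apply: eq_big => [[q p] //|u _]; exact: (congr1 G (tagnat.rankK u)).
Qed.

Lemma Rank_lt q q' (p : 'I_(k q)) (p' : 'I_(k q')) : q < q' -> Rank q p < Rank q' p'.
Proof.
move=> qq'; rewrite ltnNge; apply/negP => /tagnat.le_sig1.
by rewrite !tagnat.Rank1K leEord leqNgt qq'.
Qed.

(** Offset of a block of a block: with F the sizes of the inner blocks, this
    compares the two ways of numbering the inputs of a threefold composite. *)
Lemma sum_lt_Rank q (p : 'I_(k q)) :
  \sum_(j < \sum_q k q | j < Rank q p) F (sig1 j) (sig2 j) =
  \sum_(q' < n | q' < q) (\sum_p' F q' p') + \sum_(p' < k q | p' < p) F q p'.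
Proof.
rewrite (sum_Rank (fun j => j < Rank q p)) (bigID (fun q' : 'I_n => q' < q)) /=; congr addn.
  by apply: eq_bigr => q' lt; apply: eq_bigl => p'; rewrite Rank_lt.
rewrite (bigD1 q) ?ltnn //= [X in _ + X]big1 ?addn0 => [|q' /andP[ge ne]].
  by apply: eq_bigl => p'; apply: (@tagnat.lt_Rank _ k q).
rewrite big_pred0 // => p'; apply/negbTE; rewrite -leqNgt; apply/ltnW/Rank_lt.
by rewrite ltn_neqAle eq_sym ne leqNgt.
Qed.

End RankSum.

Section OperadLaws.
Variable d : nat.
Local Notation P := (lattice_operad d).

Lemma Rank_ord1 (k : 'I_1 -> nat) q (p : 'I_(k q)) : Rank q p = p :> nat.
Proof. by rewrite tagnat.RankEsum big_pred0 // => i; rewrite !ord1. Qed.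

Lemma Rank_const1 n (q : 'I_n) (p : 'I_1) : @tagnat.Rank n (fun _ => 1) q p = q :> nat.
Proof.
rewrite tagnat.RankEsum (ord1 p) addn0 -(big_ord_widen n (fun _ => 1)) ?(ltnW (ltn_ord q)) //.
by rewrite sum1_card card_ord.
Qed.

Lemma lattice_unitl n (S : 'I_n -> tree d) T (w : P n S T) :
  total_op (op_comp P (op_unit P T) (fun _ => w)) = total_op w.
Proof.
apply: total_path_eq => [|j|i h x y f].
- by rewrite big_const_ord /= addn0.
- exists (sig2 j) => //; rewrite -[in RHS](tagnat.sig2K j); exact/esym/Rank_ord1.
- rewrite comp_word weight_theta_path map_hom_word.
  by apply: eq_label_weight => p; apply: Rank_ord1.
Qed.

Lemma lattice_unitr n (S : 'I_n -> tree d) T (w : P n S T) :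
  total_op (op_comp P w (fun q => op_unit P (S q))) = total_op w.
Proof.
apply: total_path_eq => [|j|i h x y f].
- by rewrite sum1_card card_ord.
- exists (sig1 j) => //; rewrite -[in RHS](tagnat.sig2K j); exact/esym/Rank_const1.
- rewrite comp_word map_hom_word; apply: eq_funny_weight => q u v g.
  rewrite pull_weightE weight_theta_path /=.
  by congr nseq; apply: Rank_const1.
Qed.

Lemma lattice_act_one n (S : 'I_n -> tree d) T (w : P n S T) :
  total_op (op_act P 1%g w) = total_op w.
Proof.
apply: total_path_eq => // [q|i h x y f].
- exists q => // k h x.
  exact: (congr1 (fun q => existT (fun U => dlev U h) (S q) (gfun w h x q)) (perm1 q)).
- rewrite act_word map_hom_word; apply: eq_label_weight => q /=.
  by rewrite invg1 perm1.
Qed.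

Lemma lattice_act_mul n (S : 'I_n -> tree d) T (s t : {perm 'I_n}) (w : P n S T) :
  total_op (op_act P (s * t)%g w) = total_op (op_act P s (op_act P t w)).
Proof.
apply: total_path_eq => // [q|i h x y f].
- exists q => // k h x.
  exact: (congr1 (fun q => existT (fun U => dlev U h) (S q) (gfun w h x q)) (permM s t q)).
- rewrite [LHS]act_word [RHS]act_word -[RHS]map_hom_word [RHS]act_word.
  by apply: eq_label_weight => q; rewrite /= invMg permM.
Qed.

Lemma lattice_assoc n (S : 'I_n -> tree d) T
    (k : 'I_n -> nat) (U : forall q, 'I_(k q) -> tree d)
    (m : forall q, 'I_(k q) -> nat) (V : forall q p, 'I_(m q p) -> tree d)
    (w : P n S T) (v : forall q, P (k q) (U q) (S q))
    (u : forall q p, P (m q p) (V q p) (U q p)) :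
  total_op (op_comp P (op_comp P w v) (fun j => u (sig1 j) (sig2 j))) =
  total_op (op_comp P w (fun q => op_comp P (v q) (u q))).
Proof.
apply: total_path_eq => [|j|i h x y f].
- exact: sum_Rank.
- exists (Rank (sig1 (sig1 j)) (Rank (sig2 (sig1 j)) (sig2 j))).
    have := sum_lt_Rank m (sig2 (sig1 j)); rewrite tagnat.sig2K => e.
    by rewrite [LHS]tagnat.RankEsum [in LHS]tagnat.RankEsum [RHS]tagnat.rect e addnA.
  move=> l h x; set q := sig1 (sig1 j); set p := sig2 (sig1 j).
  have e1 := comp_point w (fun q => lattice_comp (v q) (u q)) (Rank p (sig2 j)) x.
  exact/esym/(etrans e1)/(comp_point (v q) (u q)).
- rewrite [RHS]comp_word [LHS]comp_word.
  (* the offset of block j in the numbering of the left-hand side *)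
  pose M (j : 'I_(\sum_q k q)) :=
    \sum_(j' < \sum_q k q | j' < j) m (sig1 j') (sig2 j').
  pose b q p := garr_weight (u q p) (label_weight (V q p) (fun r => M (Rank q p) + r) h).
  rewrite [LHS](@weight_lattice_comp _ _ _ _ _ _ _ _ _ _ _ _ b) => [|j a c g].
    apply: eq_funny_weight => q a c g; rewrite !pull_weightE -map_hom_word [RHS]comp_word.
    apply: eq_funny_weight => p a' c' g'; apply: eq_label_weight => r.
    by rewrite /M [RHS]tagnat.RankEsum [in RHS]tagnat.RankEsum sum_lt_Rank addnA.
  apply: eq_label_weight => r; rewrite tagnat.sig2K; exact: tagnat.RankEsum.
Qed.

(** Under the transport along [block_perm_sum], [block_perm] takes input p of
    block q to input p of block s q; the points and the words follow. *)
Lemma lattice_comp_actl n (S : 'I_n -> tree d) T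
    (k : 'I_n -> nat) (U : forall q, 'I_(k q) -> tree d) (s : {perm 'I_n})
    (w : P n S T) (v : forall q, P (k q) (U q) (S q)) :
  total_op (op_comp P (op_act P s w) (fun q => v (s q))) =
  total_op (op_act P (block_perm k s) (op_comp P w v)).
Proof.
have block_permE q (p : 'I_(k (s q))) :
  block_perm k s (cast_ord (esym (block_perm_sum k s)) (@tagnat.Rank n (k \o s) q p)) =
  Rank (s q) p.
  rewrite permE /block_perm_fun cast_ord_comp cast_ord_id.
  pose G (u : {q & 'I_(k (s q))}) := Rank (s (tag u)) (tagged u).
  exact: (congr1 G (@tagnat.rankK _ (k \o s) (Tagged _ p))).
apply: total_path_eq => [|j|i h x y f].
- exact/esym/block_perm_sum.
- exists (cast_ord (esym (block_perm_sum k s)) j) => // l h x.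
  rewrite -[in RHS](tagnat.sig2K j).
  pose G j := existT (fun U => dlev U h) (U (sig1 j) (sig2 j))
    (gfun (op_comp P w v : lattice_path _ _) h x j).
  apply: esym; apply: etrans (congr1 G (block_permE _ (sig2 j))) _.
  exact: comp_point.
- rewrite [LHS]comp_word [RHS]act_word -map_hom_word [RHS]comp_word.
  apply: weight_funny_reindex => q a c g; rewrite !pull_weightE.
  by apply: eq_label_weight => p; rewrite /= -block_permE permK.
Qed.

Lemma lattice_comp_actr n (S : 'I_n -> tree d) T
    (k : 'I_n -> nat) (U : forall q, 'I_(k q) -> tree d)
    (t : forall q, {perm 'I_(k q)}) (w : P n S T) (v : forall q, P (k q) (U q) (S q)) :
  total_op (op_comp P w (fun q => op_act P (t q) (v q))) =
  total_op (op_act P (sum_perm t) (op_comp P w v)).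
Proof.
have sum_permE q (p : 'I_(k q)) : sum_perm t (Rank q p) = Rank q (t q p).
  rewrite permE /sum_perm_fun.
  pose G (u : {q & 'I_(k q)}) := Rank (tag u) (t (tag u) (tagged u)).
  exact: (congr1 G (tagnat.rankK (Tagged _ p))).
apply: total_path_eq => // [j|i h x y f].
- exists j => // l h x; rewrite -[in RHS](tagnat.sig2K j).
  pose G j := existT (fun U => dlev U h) (U (sig1 j) (sig2 j))
    (gfun (op_comp P w v : lattice_path _ _) h x j).
  apply: esym; apply: etrans (congr1 G (sum_permE _ (sig2 j))) _.
  exact: comp_point.
- rewrite [LHS]comp_word [RHS]act_word -map_hom_word [RHS]comp_word.
  apply: eq_funny_weight => q a c g; rewrite !pull_weightE -map_hom_word [LHS]act_word.
  by apply: eq_label_weight => p; rewrite /= -[p in RHS](permKV (t q)) -sum_permE permK.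
Qed.

End OperadLaws.

(** * Unary operations *)

Section Unary.
Variables (d : nat) (S T : tree d).

Definition path_theta (w : lattice_path (fun _ : 'I_1 => S) T) : theta S T.
Proof.
refine (@Theta d S T (fun k h y => gfun w h y ord0) _ _ _ _).
- by move=> k h y; exact: (congr1 (fun g => g ord0) (gfun_dn w y)).
- by move=> k h y; exact: (congr1 (fun g => g ord0) (gfun_lo w y)).
- by move=> k h y; exact: (congr1 (fun g => g ord0) (gfun_hi w y)).
- by move=> k h y z yz; exact: (proj ord0 (garr w h (yz : hom (arr (disk T) h) y z))).
Defined.

(** The arity is only assumed equal to 1, so that the lemma also applies to a
    composite of unary operations, of arity a sum over 'I_1. *)
Lemma unary_word n (S' : 'I_n -> tree d) (i : 'I_n) L (l : 'I_n -> L) :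
  n = 1 -> forall k (h : k < d) x y (m : hom (arr (gfunny (fun q => disk (S' q))) h) x y),
  map l (hom_word m) = nseq (dist (x i) (y i)) (l i).
Proof.
move=> n1 k h x y m; rewrite map_hom_word.
have i1 : forall j j' : 'I_n, j = j' by rewrite n1 => j j'; rewrite !ord1.
pose a q := @dist_weight d (S' q) k h L (l q).
have off j u v (f : hom (arr (disk (S' j)) h) u v) : j != i -> wt (a j) f = [::].
  by move=> /eqP[]; apply: i1.
by have [f ->] := funny_weight_single off m.
Qed.

Lemma theta_path_bij : bijective (@theta_path d S T).
Proof.
exists path_theta => [[u p1 p2 p3 p4]|w].
  by rewrite /path_theta; congr Theta; apply: Prop_irrelevance.
apply: lattice_path_eq => [k h x q|k h x y f]; first by rewrite (ord1 q).
by rewrite -[LHS]map_id -[RHS]map_id !(unary_word ord0).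
Qed.

End Unary.

Lemma theta_path_comp d S T U (G : theta T U) (F : theta S T) :
  total_op (P := lattice_operad d) (theta_path (theta_comp G F)) =
  total_op (op_comp (lattice_operad d) (theta_path G) (fun _ => theta_path F)).
Proof.
have n1 : 1 = \sum_(q < 1) 1 by rewrite big_ord1.
have z1 : 0 < \sum_(q < 1) 1 by rewrite -n1.
apply: total_path_eq => [//|q|k h x y f].
  by exists (cast_ord n1 q).
by rewrite (unary_word ord0) // (unary_word (Ordinal z1)).
Qed.

Lemma lattice_theta_coloured d :
  theta_coloured (P := lattice_operad d) (@theta_path d).
Proof.
split; [exact: theta_path_bij|by []|exact: theta_path_comp].
Qed.

(** * Complexity *)

Section Changes.
Variable A : eqType.
Implicit Types (x y : A) (s t : seq A).

(** The changes of x :: s; fixing a preceding letter makes the count additive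
    along concatenation. *)
Definition changes_from x s : nat := count id (pairmap (fun y z => y != z) x s).

Lemma changes_from_le x s : changes s <= changes_from x s.
Proof. by case: s => //= y s; apply: leq_addl. Qed.

Lemma changes_from_ex x s : exists y, changes s = changes_from y s.
Proof. by case: s => [|y s]; [exists x|exists y; rewrite /changes_from /= eqxx]. Qed.

Lemma changes_from_nseq x y m s :
  changes_from x (nseq m.+1 y ++ s) = (x != y) + changes_from y s.
Proof.
rewrite /changes_from /=; congr addn; elim: m => //= m ->.
by rewrite eqxx.
Qed.

Lemma changes_map (B : eqType) (g : A -> B) s :
  {in s &, injective g} -> changes (map g s) = changes s.
Proof.
case: s => //= x s; elim: s x => //= y s IH x inj.
congr addn; last by apply: IH => u v us vs; apply: inj; rewrite in_cons ?us ?vs orbT.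
congr nat_of_bool; congr negb; apply/eqP/eqP => [|-> //].
by apply: inj; rewrite !in_cons eqxx ?orbT.
Qed.

End Changes.

(** Neither shortening nor deleting constant blocks creates changes.  As deleting
    a block alters the letter that precedes the next one, the induction allows
    different preceding letters l and l' at the cost of one change. *)
Lemma changes_funny_weight (I : finType) (O : I -> Type) (C : forall i, category (O i))
    (a b : forall i, weight (C i) I) :
  (forall i x y (f : hom (C i) x y), all (pred1 i) (wt (a i) f)) ->
  (forall i x y (f : hom (C i) x y), all (pred1 i) (wt (b i) f)) ->
  (forall i x y (f : hom (C i) x y), wt (b i) f = [::] -> wt (a i) f = [::]) ->
  forall x y (m : hom (funny C) x y),
    changes (wt (funny_weight a) m) <= changes (wt (funny_weight b) m).
Proof.
move=> ai bi ba x y m; rewrite -(wreprK m) !funny_weight_class.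
move: (wrepr m) => p {m}.
suff le l l' : changes_from l (walk_weight a p) <=
    (l != l') + changes_from l' (walk_weight b p).
  case e: (walk_weight a p) => [//|l s]; rewrite -e.
  have [l' ->] := changes_from_ex l (walk_weight b p).
  by apply: leq_trans (changes_from_le l' _) _; have := le l' l'; rewrite eqxx.
elim: p l l' => {x y} [x|x y z [i f e] p IH] l l'; first exact: leq0n.
rewrite /= (all_pred1P _ _ (ai i _ _ f)) (all_pred1P _ _ (bi i _ _ f)).
case fb: (size (wt (b i) f)) => [|m].
  by rewrite (ba _ _ _ _ (size0nil fb)).
rewrite changes_from_nseq addnA.
apply: (@leq_trans ((l != i) + changes_from i (walk_weight b p))); last first.
  rewrite leq_add2r; case: (eqVneq l i) => // li.
  by case: (eqVneq l l') => // <-; rewrite li.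
case: (size (wt (a i) f)) => [|m']; first exact: IH.
by rewrite changes_from_nseq leq_add2l; apply: leq_trans (IH i i) _; rewrite eqxx.
Qed.

Section PathComplexity.
Variables (d n : nat) (S : 'I_n -> tree d) (T : tree d) (w : lattice_path S T).

(** Keeping two letters is symmetric in them; this form is stable under
    renaming, which may reverse the order of the indices. *)
Lemma level_complexityP k (h : k < d) c :
  reflect (forall (a : node T (ltnW h)) (i j : 'I_n), i != j ->
             changes [seq r <- path_word w a | (r == i) || (r == j)] <= c)
          (level_complexity w h <= c).
Proof.
apply: (iffP idP) => [le a i j ij|le].
  wlog lt : i j ij / i < j => [W|].
    have [/W|ji|/val_inj e] := ltngtP i j; first exact.
      rewrite (eq_filter (a2 := fun r => (r == j) || (r == i))) => [|r].
        by apply: W; rewrite // eq_sym.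
      exact: orbC.
    by rewrite e eqxx in ij.
  have /bigmax_leqP/(_ a isT)/bigmax_leqP/(_ i isT)/bigmax_leqP := le.
  by apply.
apply/bigmax_leqP => a _; apply/bigmax_leqP => i _; apply/bigmax_leqP => j ij.
by apply: le; rewrite neq_ltn ij.
Qed.

Lemma fibre_changes k (h : k < d) (z : dlev T (ltnW h)) x y
    (f : hom (arr (disk T) h) x y) (i j : 'I_n) :
  x = dlo h z -> y = dhi h z -> i != j ->
  changes [seq r <- hom_word (garr w h f) | (r == i) || (r == j)]
    <= level_complexity w h.
Proof.
move=> ex ey ij; subst x y.
case: z f => [a|e] f; last first.
  (* dlo and dhi agree at an external point, so that f is an identity *)
  rewrite (bool_irrelevance f (idn (arr (disk T) h) _)) garr_idn.
  by rewrite [hom_word _]hom_word_class.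
by rewrite (bool_irrelevance f (dlo_hi (inl a))); apply/level_complexityP: ij.
Qed.

End PathComplexity.

Section CompComplexity.
Variables (d n : nat) (S : 'I_n -> tree d) (T : tree d) (w : lattice_path S T).
Variables (k : 'I_n -> nat) (U : forall q, 'I_(k q) -> tree d).
Arguments U : clear implicits.
Variable v : forall q, lattice_path (U q) (S q).
Variables (l : nat) (h : l < d).

(** Erasing letters of the word of a composite amounts to erasing them in the
    words substituted for the steps of w. *)
Lemma filter_comp_word (Q : pred 'I_(\sum_q k q)) :
  exists a : forall q, weight (arr (disk (S q)) h) 'I_(\sum_q k q),
    (forall q x y (f : hom (arr (disk (S q)) h) x y),
       wt (a q) f = [seq Rank q r | r <- hom_word (garr (v q) h f) & Q (Rank q r)]) /\
    forall x y (f : hom (arr (disk T) h) x y),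
      [seq r <- hom_word (garr (lattice_comp w v) h f) | Q r] =
        wt (funny_weight a) (garr w h f).
Proof.
exists (fun q => image_weight (g := filter Q) erefl (@filter_cat _ Q)
  (garr_weight (v q) (label_weight (U q) (Rank q) h))); split=> [q x y f|x y f].
  rewrite -[LHS]/(filter Q (wt (label_weight (U q) (Rank q) h) (garr (v q) h f))).
  by rewrite -map_hom_word filter_map.
rewrite -[hom_word _]map_id comp_word.
exact: (@morph_funny_weight _ _ (filter Q) erefl (@filter_cat _ Q)).
Qed.

(** The steps of w in direction q make up an arrow between the end points of the
    fibre over the q-th component of the image of z. *)
Lemma changes_same_block (z : dlev T (ltnW h))
    (f : hom (arr (disk T) h) (dlo h z) (dhi h z))
    q (r r' : 'I_(k q)) : r != r' ->
  changes [seq j <- hom_word (garr (lattice_comp w v) h f)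
             | (j == Rank q r) || (j == Rank q r')] <= level_complexity (v q) h.
Proof.
move=> rr'.
have RankE (p p' : 'I_(k q)) : (Rank q p == Rank q p') = (p == p').
  by rewrite -val_eqE tagnat.eq_Rank eqxx.
have [a [aE ->]] := filter_comp_word (fun j => (j == Rank q r) || (j == Rank q r')).
have off q' x y (g : hom (arr (disk (S q')) h) x y) : q' != q -> wt (a q') g = [::].
  move=> qq'; rewrite aE (eq_filter (a2 := pred0)) ?filter_pred0 // => p /=.
  by rewrite -!val_eqE !tagnat.eq_Rank (negbTE qq').
have [g ->] := funny_weight_single off (garr w h f).
rewrite aE changes_map => [|p p' _ _ /eqP]; last by rewrite RankE => /eqP.
rewrite (eq_filter (a2 := fun p => (p == r) || (p == r'))) => [|p]; last by rewrite !RankE.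
apply: (@fibre_changes _ _ _ _ _ _ _ (gfun w (ltnW h) z q)) => //.
  exact: (congr1 (fun u => u q) (gfun_lo w z)).
exact: (congr1 (fun u => u q) (gfun_hi w z)).
Qed.

(** As the blocks differ, replacing each of the two kept letters with its block is
    injective; it turns the word into one made of powers of the directions of the steps of w. *)
Lemma changes_distinct_blocks x y (f : hom (arr (disk T) h) x y)
    q q' (r : 'I_(k q)) (r' : 'I_(k q')) : q != q' ->
  changes [seq j <- hom_word (garr (lattice_comp w v) h f)
             | (j == Rank q r) || (j == Rank q' r')] <=
  changes [seq p <- hom_word (garr w h f) | (p == q) || (p == q')].
Proof.
move=> qq'; pose Q j := (j == Rank q r) || (j == Rank q' r').
pose Q' p := (p == q) || (p == q'); rewrite -[X in changes X <= _]/(filter Q _).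
rewrite -[X in _ <= changes X]/(filter Q' _).
rewrite -(@changes_map _ _ (@sig1 _ k)); last first.
  move=> i j; rewrite !mem_filter => /andP[/orP[]/eqP-> _] /andP[/orP[]/eqP-> _] //;
    rewrite !tagnat.Rank1K => e; by rewrite e eqxx in qq'.
have [a [aE ->]] := filter_comp_word Q.
pose a1 q := image_weight (g := map (@sig1 _ k)) erefl (map_cat _) (a q).
pose b1 p := image_weight (g := filter Q') erefl (@filter_cat _ Q')
  (@dist_weight d (S p) l h _ p).
rewrite (@morph_funny_weight _ _ (map (@sig1 _ k)) erefl (map_cat _) _ _ _ a a1) //.
have -> : filter Q' (hom_word (garr w h f)) = wt (funny_weight b1) (garr w h f).
  rewrite -[hom_word _]map_id map_hom_word.
  exact: (@morph_funny_weight _ _ (filter Q') erefl (@filter_cat _ Q')).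
have a1E p u t (g : hom (arr (disk (S p)) h) u t) :
  wt (a1 p) g = [seq p | i <- hom_word (garr (v p) h g) & Q (Rank p i)].
  rewrite -[LHS]/(map _ (wt (a p) g)) aE -map_comp; apply: eq_map => i /=.
  exact: tagnat.Rank1K.
have b1E p u t (g : hom (arr (disk (S p)) h) u t) :
  wt (b1 p) g = filter Q' (nseq (dist u t) p) by [].
apply: changes_funny_weight => p u t g; rewrite ?a1E ?b1E.
- by apply/allP => i /mapP[j _ ->] /=.
- by apply/allP => i; rewrite mem_filter mem_nseq => /and3P[_ _ /=].
(* no letter q or q' arises from a step in another direction, or from an identity *)
rewrite filter_nseq; case Qp: (Q' p); rewrite ?mul1n => gt.
  have ut : u = t by apply: (dist0 g); apply/eqP; move: gt; case: (dist u t).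
  case: t / ut g {gt} => g; rewrite (bool_irrelevance g (idn (arr (disk (S p)) h) _)).
  by rewrite garr_idn [hom_word _]hom_word_class.
rewrite (eq_filter (a2 := pred0)) ?filter_pred0 // => i /=; apply: contraFF Qp.
rewrite /Q /Q' -!val_eqE !tagnat.eq_Rank -!val_eqE.
by case/orP=> /andP[-> _]; rewrite ?orbT.
Qed.

End CompComplexity.

Lemma lattice_suboperad d (c : 'I_d -> nat) :
  symmetric_suboperad (P := lattice_operad d)
    (fun (n : nat) (S : 'I_n -> tree d) (T : tree d) (w : lattice_path S T) =>
       complexity_le c w).
Proof.
split=> [T i|n S T k U w v wc vc i|n S T s w wc i].
- by apply/level_complexityP => a j j'; rewrite (ord1 j) (ord1 j').
- apply/level_complexityP => a j j'.
  rewrite -(tagnat.sig2K j) -(tagnat.sig2K j').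
  move: (sig1 j) (sig2 j) (sig1 j') (sig2 j') => q r q' r' ne.
  have [qq'|qq'] := eqVneq q q'.
    case: q' / qq' r' ne => r' ne; apply: leq_trans (vc q i).
    apply: changes_same_block; by apply: contra ne => /eqP ->.
  apply: leq_trans (changes_distinct_blocks w v _ r r' qq') _.
  by have /level_complexityP := wc i; apply.
- apply/level_complexityP => a j j' ne; rewrite /path_word -[hom_word _]map_id act_word.
  rewrite -map_hom_word filter_map changes_map; last by move=> ? ? _ _; apply: perm_inj.
  rewrite (eq_filter (a2 := fun r => (r == s j) || (r == s j'))) => [|r].
    have /level_complexityP := wc i; apply; by rewrite (inj_eq perm_inj).
  by rewrite /= !(canF_eq (permKV s)).
Qed.

Theorem proposition2p5 (d : nat) (hd : 0 < d) :
  symmetric_operad (lattice_operad d) /\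
  theta_coloured (P := lattice_operad d) (@theta_path d) /\
  forall c : 'I_d -> nat,
    symmetric_suboperad (P := lattice_operad d)
      (fun (n : nat) (S : 'I_n -> tree d) (T : tree d) (w : lattice_path S T) =>
         complexity_le c w).
Proof.
split; last by split; [exact: lattice_theta_coloured|exact: lattice_suboperad].
split.
- exact: lattice_unitl.
- exact: lattice_unitr.
- exact: lattice_assoc.
- exact: lattice_act_one.
- exact: lattice_act_mul.
- exact: lattice_comp_actl.
- exact: lattice_comp_actr.
Qed.
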